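(* Let $r\geq 3$. Every quasi-linear, head-tail-mixing $r$-graph $F$ which admits the descriptive sequence $X X\cdots X Z Z Y Y\cdots Y$ (consisting of $r-2$ letters $X$, followed by two letters $Z$, followed by $r-2$ letters $Y$) satisfies $\pi_u(F)=1/4$.
   Context: An $r$-graph is an $r$-uniform hypergraph. For an $r$-graph $H$ and $S\subseteq V(H)$, $e(S)$ is the number of edges of $H$ inside $S$. $H$ is $(d,\varepsilon)$-dense if every $S\subseteq V(H)$ with $|S|\geq\varepsilon|V(H)|$ has $e(S)\geq(d-\varepsilon)\binom{|S|}{r}$. A sequence $(H_n)$ of $r$-graphs is locally $d$-dense if there are $\varepsilon_n\to0$ with each $H_n$ $(d,\varepsilon_n)$-dense and $|V(H_n)|\to\infty$. $\pi_u(F)$ is the maximum $d$ such that some locally $d$-dense sequence of $r$-graphs avoids $F$ as a subgraph. A hypergraph $H$ is quasi-linear if for every edge $e$ there is a unique other edge $f$ (its twin) with $|e\cap f|=2$, and every edge $f'\notin\{e,f\}$ satisfies $|e\cap f'|\leq1$. A descriptive sequence of order $k$ is a sequence $\sigma=(s_1,\dots,s_{2k-2})$ over $\{X,Y,Z\}$ with exactly $k-2$ letters $X$, $k-2$ letters $Y$ and two letters $Z$. Given a linearly ordered vertex set and two edges $e,f$ with $|e\cap f|=2$ and $|e|=|f|=k$, sort $e\cup f$ as $w_1\prec\dots\prec w_{2k-2}$; $\sigma$ describes $\{e,f\}$ if either ($s_i=X$ iff $w_i\in e\setminus f$, $s_i=Y$ iff $w_i\in f\setminus e$, $s_i=Z$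 iff $w_i\in e\cap f$) or the same holds with $e$ and $f$ swapped. A quasi-linear hypergraph admits $\sigma$ if there is a linear order of its vertex set in which every twin pair of edges is described by $\sigma$. Given a linear order on the vertices, the head of an edge is the set of its two smallest vertices and its tail is the set of its two largest vertices. A hypergraph is head-tail-mixing if for every linear order of its vertex set there exist edges $e,f$ such that the head of $e$ equals the tail of $f$. *)

(* Defs.v *)
From HB Require Import structures.
From mathcomp Require Import all_boot all_order all_algebra.
From mathcomp Require Import all_classical all_reals all_analysis.
Import Order.TTheory GRing.Theory Num.Theory.
Import numFieldNormedType.Exports.

Set Implicit Arguments.
Unset Strict Implicit.
Unset Printing Implicit Defensive.

Local Open Scope ring_scope.

Record hypergraph := Hypergraph {
  vertex : finType;
  edges : {set {set vertex}}
}.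

Definition is_uniform (r : nat) (H : hypergraph) : Prop :=
  forall e : {set vertex H}, e \in edges H -> #|e| = r.

Record r_graph (r : nat) := RGraph {
  r_graph_hypergraph :> hypergraph;
  r_graph_uniform : is_uniform r r_graph_hypergraph
}.

Definition edges_in (H : hypergraph) (S : {set vertex H}) : nat :=
  #|[set e in edges H | e \subset S]%SET|.

(* Not necessarily induced subgraphs. *)
Definition contains (H F : hypergraph) : Prop :=
  exists phi : vertex F -> vertex H,
    injective phi /\
    forall e : {set vertex F}, e \in edges F -> [set phi x | x in e]%SET \in edges H.

Definition de_dense (R : realType) (r : nat) (d eps : R) (H : r_graph r) : Prop :=
  forall S : {set vertex H},
    eps * #|vertex H|%:R <= #|S|%:R ->
    (d - eps) * 'C(#|S|, r)%:R <= (edges_in S)%:R.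

Definition locally_dense (R : realType) (r : nat) (d : R)
    (H : nat -> r_graph r) : Prop :=
  (exists eps : nat -> R,
     (eps @ \oo --> (0 : R))%classic /\ forall n, de_dense d (eps n) (H n)) /\
  ((fun n => #|vertex (H n)|) @ \oo --> \oo)%classic.

Definition avoidable_density (R : realType) (r : nat) (F : r_graph r) (d : R)
    : Prop :=
  exists H : nat -> r_graph r,
    locally_dense d H /\ forall n, ~ contains (H n) F.

(* [is_pi_u F d] reads "pi_u(F) = d": d is the maximum of the avoidable
   densities, i.e. it is attained and it bounds all of them. *)
Definition is_pi_u (R : realType) (r : nat) (F : r_graph r) (d : R) : Prop :=
  avoidable_density F d /\ forall d' : R, avoidable_density F d' -> d' <= d.

Definition twins (H : hypergraph) (e f : {set vertex H}) : Prop :=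
  [/\ e \in edges H, f \in edges H, f != e & #|e :&: f| = 2%N].

Definition quasi_linear (H : hypergraph) : Prop :=
  forall e : {set vertex H}, e \in edges H ->
    exists f : {set vertex H}, unique (fun g => twins e g) f /\
      forall f' : {set vertex H}, f' \in edges H -> f' \notin [set e; f]%SET ->
        (#|e :&: f'| <= 1)%N.

Definition linear_order (T : Type) (le : rel T) : Prop :=
  [/\ reflexive le, antisymmetric le, transitive le & total le].

Definition sorted_set (T : finType) (le : rel T) (A : {set T}) : seq T :=
  sort le (enum A).

Inductive letter := LX | LY | LZ.

Definition letter_eqb (a b : letter) : bool :=
  match a, b with
  | LX, LX | LY, LY | LZ, LZ => true
  | _, _ => false
  end.

Lemma letter_eqP : Equality.axiom letter_eqb.
Proof. by move=> [] []; constructor. Qed.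

HB.instance Definition _ := hasDecEq.Build letter letter_eqP.

Definition descriptive (k : nat) (s : seq letter) : bool :=
  [&& size s == (2 * k - 2)%N, count_mem LX s == (k - 2)%N,
      count_mem LY s == (k - 2)%N & count_mem LZ s == 2%N].

Definition letter_of (T : finType) (e f : {set T}) (w : T) : letter :=
  if w \in e then (if w \in f then LZ else LX) else LY.

(* Since the sorted sequence only lists elements of e :|: f, the letter LY
   marks exactly the elements of f :\: e. *)
Definition describes (T : finType) (le : rel T) (s : seq letter)
    (e f : {set T}) : Prop :=
  let w := sorted_set le (e :|: f) in
  s = map (letter_of e f) w \/ s = map (letter_of f e) w.

Definition admits (H : hypergraph) (s : seq letter) : Prop :=
  exists le : rel (vertex H), linear_order le /\
    forall e f : {set vertex H}, twins e f -> describes le s e f.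

Definition xzy_seq (r : nat) : seq letter :=
  nseq (r - 2) LX ++ nseq 2 LZ ++ nseq (r - 2) LY.

Lemma xzy_seq_descriptive (r : nat) : (2 <= r)%N -> descriptive r (xzy_seq r).
Proof.
move=> r2; have size_eq : (2 * r - 2 = (r - 2) + (2 + (r - 2)))%N.
  by rewrite subnKC // mul2n -addnn addnBAC.
rewrite /descriptive /xzy_seq size_eq !size_cat !size_nseq.
by apply/and4P; split; apply/eqP;
   rewrite ?count_cat ?count_nseq /= ?mul0n ?mul1n ?addn0 ?add0n.
Qed.

Definition edge_head (T : finType) (le : rel T) (e : {set T}) : {set T} :=
  [set x in take 2 (sorted_set le e)]%SET.

Definition edge_tail (T : finType) (le : rel T) (e : {set T}) : {set T} :=
  [set x in drop (#|e| - 2) (sorted_set le e)]%SET.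

Definition head_tail_mixing (H : hypergraph) : Prop :=
  forall le : rel (vertex H), linear_order le ->
    exists e f : {set vertex H}, [/\ e \in edges H, f \in edges H
                  & edge_head le e = edge_tail le f].

(* Main.v *)
Require Import Defs.
From mathcomp Require Import all_boot all_order all_algebra.
From mathcomp Require Import all_classical all_reals all_analysis.
From mathcomp Require Import zify ring lra.
Import Order.TTheory GRing.Theory Num.Theory.

Set Implicit Arguments.
Unset Strict Implicit.
Unset Printing Implicit Defensive.

Local Open Scope ring_scope.

(* Lower bound: colour the pairs of an ordered vertex set red or blue at random
   and take as edges the r-sets with red head and blue tail; the density is
   1/4 on every large set, and a head-tail-mixing F would force a pair to have
   both colours.

   Upper bound: split the vertices of H into many parts V_i.  A block is an
   increasing sequence of 2r - 2 parts; its first r and its last r parts share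
   the two middle ones.  After shrinking the parts, every block is either good
   (some set Q of middle pairs is such that every dense box spans many edges
   with tail in Q, and every dense subset of Q many edges with head in it) or
   null (some Q contains almost no tail, and its complement almost no head).
   By Ramsey all blocks may be taken of the same type.  If all are good, F is
   embedded by adding its twin pairs one at a time: any other edge of F meets
   an edge in at most one vertex, so resampling the vertices of that edge ranges
   over a box, and the number of partial copies stays positive.  If all are null,
   almost every edge has its tail in a set C of pairs and its head outside C;
   making the densities of C uniform, again by Ramsey, the density of H on a
   union of parts is at most about x(1 - x) <= 1/4. *)

(** * Ramsey's theorem for finite sets *)

(** Richness of a good block is promised only above a fixed density, and each twin pair added lowers
    the density of partial copies. Blocks thus need a decreasing hierarchy of thresholds, while
    shrinking the parts for one block weakens what was secured for the others. The conflict
    disappears because the constants of a block depend on its threshold alone: they are fixed in the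
    order of embedding, the parts are shrunk in the reverse order, and the loss caused by later
    shrinking is paid in advance.

    In the null case the factor x(1 - x) cannot come from independence of head and tail: for r = 3
    they share the middle vertex. Hence uniformity is imposed on degrees rather than on densities:
    all vertices of a later part have nearly the same degree in C into an earlier part. Resampling
    the smallest vertex of an edge, which lies outside the tail, then yields 1 - x whatever the
    other vertices are. *)

Lemma ramsey (p q m : nat) :
  exists M : nat, forall (T : finType) (D : {set T}) (col : {set T} -> 'I_q.+1),
    (M <= #|D|)%N ->
    exists J : {set T}, [/\ J \subset D, #|J| = m &
      exists c, forall A : {set T}, A \subset J -> #|A| = p -> col A = c].
Proof.
elim: p m => [|p IHp] m.
  exists m => T D col mD.
  have [s [us ss sD]] : exists s : seq T, [/\ uniq s, size s = m & {subset s <= D}].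
    exists (take m (enum D)); rewrite take_uniq ?enum_uniq // size_takel -?cardE //.
    by split=> // x /mem_take; rewrite mem_enum.
  exists [set x in s]%SET; split.
  - by apply/fintype.subsetP => x; rewrite inE; apply: sD.
  - by rewrite cardsE (card_uniqP us).
  - by exists (col finset.set0) => A _ /eqP; rewrite cards_eq0 => /eqP ->.
(* End-homogeneous sequences: the colour of a set depends only on its first element. After choosing
   [x], the induction hypothesis on [p] is applied to the colouring of [A] by [col (x |: A)], and
   the construction continues inside the homogeneous set. *)
have endhom k : exists M : nat, forall (T : finType) (D : {set T})
    (col : {set T} -> 'I_q.+1), (M <= #|D|)%N ->
    exists (s : seq T) (g : T -> 'I_q.+1), [/\ uniq s, size s = k,
      {subset s <= D} & forall (s1 s2 : seq T) x, s = s1 ++ x :: s2 ->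
        forall A : {set T}, {subset A <= s2} -> #|A| = p -> col (x |: A)%SET = g x].
  elim: k => [|k [Mk IHk]].
    exists 0%N => T D col _; exists [::], (fun=> ord0); split => //.
    by move=> [].
  have [M HM] := IHp Mk.
  exists M.+1 => T D col MD.
  have /card_gt0P[x xD] : (0 < #|D|)%N by exact: leq_ltn_trans MD.
  have MDx : (M <= #|D :\ x|)%N by move: MD; rewrite (cardsD1 x) xD.
  have [J [JD cJ [c Hc]]] := HM T (D :\ x)%SET (fun A => col (x |: A)%SET) MDx.
  have [s [g [us ss sJ Hs]]] := IHk T J col (eq_leq (esym cJ)).
  have xs : x \notin s.
    by apply/negP => /sJ /(fintype.subsetP JD); rewrite !inE eqxx.
  exists (x :: s), (fun y => if y == x then c else g y); split => //=.
  - by rewrite xs.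
  - by rewrite ss.
  - move=> y; rewrite inE => /orP[/eqP -> //|/sJ /(fintype.subsetP JD)].
    by rewrite !inE => /andP[].
  - move=> [|y s1] s2 z /= [xz ss2] A As cA.
      rewrite -xz eqxx; apply: Hc => //.
      by apply/fintype.subsetP => w /As; rewrite -ss2 => /sJ.
    rewrite ifN; last first.
      by apply: contraNneq xs => zx; rewrite ss2 mem_cat inE zx eqxx orbT.
    exact: Hs ss2 A As cA.
have [M HM] := endhom (m * q.+1)%N.
exists M => T D col MD.
have [s [g [us ss sD Hs]]] := HM T D col MD.
(* Pigeonhole over the first-element colours: [m] terms of the sequence share one of them. *)
have [c Hc] : exists c, (m <= count (fun x => g x == c) s)%N.
  apply/not_existsP => nc.
  have H : (\sum_(c < q.+1) count (fun x => g x == c) s)%N = (m * q.+1)%N.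
    rewrite -ss; elim: (s) => [|x s' IHs] /=; first by rewrite big1.
    rewrite big_split /= IHs (bigD1 (g x)) //= eqxx big1 ?addn0 // => c cgx.
    by rewrite eq_sym (negPf cgx).
  have [m0|m0] := posnP m; first by apply: (nc ord0); rewrite m0.
  have : (\sum_(c < q.+1) count (fun x => g x == c) s <= \sum_(c < q.+1) m.-1)%N.
    by apply: leq_sum => c _; move/negP: (nc c); rewrite -ltnNge; lia.
  rewrite H sum_nat_const card_ord; nia.
pose s' := take m (seq.filter (fun x => g x == c) s).
have us' : uniq s' by rewrite take_uniq // filter_uniq.
have s's x : x \in s' -> x \in s /\ g x = c.
  by move/mem_take; rewrite mem_filter => /andP[/eqP].
exists [set x in s']%SET; split.
- by apply/fintype.subsetP => x; rewrite inE => /s's[/sD].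
- by rewrite cardsE (card_uniqP us') size_takel // size_filter.
exists c => A AJ cA.
have hasA : has (fun x => x \in A) s.
  have /card_gt0P[x xA] : (0 < #|A|)%N by rewrite cA.
  apply/hasP; exists x => //; have := fintype.subsetP AJ _ xA.
  by rewrite inE => /s's[].
have [x [s1 [s2 [Es' xA s1A]]]] : exists x s1 s2,
    [/\ s = s1 ++ x :: s2, x \in A & ~~ has (fun y => y \in A) s1].
  by case/split_find: hasA => x s1 s2 xA s1A; exists x, s1, s2; rewrite cat_rcons.
have gx : g x = c by have := fintype.subsetP AJ _ xA; rewrite inE => /s's[].
rewrite -gx -(finset.setD1K xA); apply: (Hs _ _ _ Es').
  move=> y; rewrite !inE => /andP[yx yA].
  have : y \in s by have := fintype.subsetP AJ _ yA; rewrite inE => /s's[].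
  rewrite Es' mem_cat inE (negPf yx) /= => /orP[] // ys1.
  by move/hasPn: s1A => /(_ _ ys1); rewrite yA.
by move: cA; rewrite (cardsD1 x) xA => -[].
Qed.

(** * Counting in boxes *)

Definition box (I T : finType) (V : I -> {set T}) : {set {ffun I -> T}} :=
  [set t : {ffun I -> T} | [forall i, t i \in V i]]%SET.

Definition count_in (R : realType) (I T : finType) (V : I -> {set T})
    (P : {ffun I -> T} -> bool) : R := \sum_(t in box V | P t) 1.

Definition volume (R : realType) (I T : finType) (V : I -> {set T}) : R :=
  count_in R V xpredT.

Definition sub_parts (I T : finType) (X V : I -> {set T}) : Prop :=
  forall i, X i \subset V i.

(* The shrinking of a system of parts is measured by the volume of its box, so
   that the parts themselves may shrink unevenly. *)
Definition shrinks (R : realType) (th : R) (I T : finType) (X V : I -> {set T}) : Prop :=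
  sub_parts X V /\ th * volume R V <= volume R X.

Definition splice (I T : finType) (g : {set I}) (t u : {ffun I -> T}) : {ffun I -> T} :=
  [ffun i => if i \in g then u i else t i].

Definition depends_on (I T : finType) (g : {set I}) (P : {ffun I -> T} -> bool) : Prop :=
  forall t u : {ffun I -> T}, {in g, t =1 u} -> P t = P u.

Section Boxes.
Variables (R : realType) (I T : finType).
Implicit Types (V X : I -> {set T}) (P Q : {ffun I -> T} -> bool) (t u : {ffun I -> T}).

Local Notation cnt := (count_in R).
Local Notation vol := (volume R).

Lemma in_box V t : reflect (forall i, t i \in V i) (t \in box V).
Proof. by rewrite inE; apply: forallP. Qed.

Lemma cnt_ge0 V P : 0 <= cnt V P.
Proof. exact: sumr_ge0. Qed.

Lemma vol_ge0 V : 0 <= vol V.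
Proof. exact: cnt_ge0. Qed.

Lemma cntE V P : cnt V P = \sum_(t in box V) (P t)%:R.
Proof.
by rewrite /count_in big_mkcondr; apply: eq_bigr => t _; case: (P t).
Qed.

Lemma sum_box_const V (a : R) : \sum_(t in box V) a = a * vol V.
Proof. by rewrite /volume cntE mulr_sumr; apply: eq_bigr => t _; rewrite mulr1. Qed.

Lemma volE V : vol V = \prod_i #|V i|%:R.
Proof.
have -> : vol V = #|box V|%:R.
  by rewrite /volume /count_in -sumr_const; apply: eq_bigl => t; rewrite andbT.
have -> : #|box V| = #|family (fun i => mem (V i))|.
  by apply: eq_card => t; apply/in_box/familyP.
by rewrite card_family foldrE big_image natr_prod.
Qed.

Lemma le_cnt V X P Q :
  (forall t, t \in box V -> P t -> t \in box X /\ Q t) -> cnt V P <= cnt X Q.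
Proof.
move=> PQ; rewrite /count_in [leRHS]big_mkcond [leLHS]big_mkcond.
apply: ler_sum => t _; case: ifP => [/andP[tV Pt]|_].
  by have [-> ->] := PQ t tV Pt.
by case: ifP.
Qed.

Lemma eq_cnt V P Q : {in box V, P =1 Q} -> cnt V P = cnt V Q.
Proof.
by move=> PQ; rewrite !cntE; apply: eq_bigr => t tV; rewrite PQ.
Qed.

Lemma sub_box X V t : sub_parts X V -> t \in box X -> t \in box V.
Proof. by move=> XV /in_box tX; apply/in_box => i; apply: (fintype.subsetP (XV i)). Qed.

Lemma le_cnt_sub X V P Q : sub_parts X V ->
  (forall t, t \in box X -> P t -> Q t) -> cnt X P <= cnt V Q.
Proof. by move=> XV PQ; apply: le_cnt => t tX Pt; split; [exact: sub_box tX|exact: PQ]. Qed.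

Lemma le_cnt_vol V P : cnt V P <= vol V.
Proof. exact: le_cnt. Qed.

Lemma le_vol X V : sub_parts X V -> vol X <= vol V.
Proof. by move=> XV; apply: le_cnt_sub. Qed.

Lemma cntU V P Q : cnt V (fun t => P t || Q t) <= cnt V P + cnt V Q.
Proof.
rewrite !cntE -big_split /=; apply: ler_sum => t _; rewrite -natrD ler_nat.
by case: (P t); case: (Q t).
Qed.

Lemma cntC V P : cnt V (fun t => ~~ P t) = vol V - cnt V P.
Proof.
apply/eqP; rewrite eq_sym subr_eq /volume !cntE -big_split /=; apply/eqP/eq_bigr => t _.
by rewrite -natrD; case: (P t).
Qed.

Lemma vol_gt0 V : (forall i, V i != finset.set0) -> 0 < vol V.
Proof.
by move=> V0; rewrite volE; apply: prodr_gt0 => i _; rewrite ltr0n card_gt0.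
Qed.

Lemma vol_neq0 V : 0 < vol V -> forall i, V i != finset.set0.
Proof.
move=> V0 i; apply: contraTneq V0 => Vi.
by rewrite volE (bigD1 i) //= Vi cards0 mul0r ltxx.
Qed.

(** The other parts contribute a factor at most 1 to the ratio of volumes, so at worst a single part
    bears the whole loss. *)
Lemma shrinks_part X V (th : R) i : 0 < vol V -> shrinks th X V ->
  th * #|V i|%:R <= #|X i|%:R.
Proof.
move=> V0 [XV].
rewrite !volE !(bigD1 (P := xpredT) i) //=.
set a := \prod_(j | _) _; set b := \prod_(j | _) _ => H.
have ba : b <= a.
  by apply: ler_prod => j _; rewrite ler0n ler_nat subset_leq_card // XV.
have a0 : 0 < a.
  by apply: prodr_gt0 => j _; rewrite ltr0n card_gt0 vol_neq0.
rewrite -(ler_pM2r a0) -mulrA (le_trans H) // ler_wpM2l //.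
Qed.

Lemma spliceK (g : {set I}) t u : splice g (splice g t u) (splice g u t) = t.
Proof. by apply/ffunP => i; rewrite !ffunE; case: (i \in g). Qed.

(* Swapping the coordinates outside [g] is a bijection of pairs, so a uniform
   [t] stays uniform after its coordinates in [g] are resampled. *)
Lemma sum_splice (g : {set I}) V X (f : {ffun I -> T} -> R) :
  {in g, V =1 X} ->
  \sum_(t in box X) \sum_(u in box V) f (splice g t u) = vol V * \sum_(t in box X) f t.
Proof.
move=> VX.
have -> : vol V * \sum_(t in box X) f t = \sum_(t in box X) \sum_(u in box V) f t.
  by rewrite mulr_sumr; apply: eq_bigr => t _; rewrite sum_box_const mulrC.
rewrite !pair_big /=.
pose h (p : {ffun I -> T} * {ffun I -> T}) := (splice g p.1 p.2, splice g p.2 p.1).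
have hK : involutive h by case=> t u; rewrite /h /= !spliceK.
rewrite [RHS](reindex_inj (inv_inj hK)) /=; apply: eq_bigl => -[t u] /=.
apply/andP/andP => -[/in_box tX /in_box uV].
  split; apply/in_box => i; rewrite ffunE; case: ifP => ig //.
    by rewrite -VX.
  by rewrite VX.
split; apply/in_box => i; have := tX i; have := uV i; rewrite !ffunE; case: ifP => ig //.
  by rewrite VX.
by rewrite VX.
Qed.

(** An event that sees only the coordinates in [g] has the same density whatever the other parts
    are. The cross-multiplied form also covers boxes of volume 0. *)
Lemma cnt_agree V X (g : {set I}) P : depends_on g P -> {in g, V =1 X} ->
  cnt V P * vol X = cnt X P * vol V.
Proof.
move=> gP VX; rewrite [RHS]mulrC [in RHS]cntE -(sum_splice _ VX) exchange_big /= cntE mulr_suml.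
apply: eq_bigr => u _; rewrite /volume /count_in mulr_sumr.
apply: eq_big => [t|t _]; first by rewrite andbT.
by rewrite mulr1; congr (_ %:R); congr nat_of_bool; apply: gP => i ig; rewrite ffunE ig.
Qed.

(** Averaging: tuples whose resampling hits [P] with density below [c / 2] account for at most half
    of the density [c], so the remaining, heavy, tuples have density at least [c / 2]; on each of
    them [P'] is hit with density at least [b]. *)
Lemma cnt_resample V (g : {set I}) P P' (c b : R) : 0 <= c -> 0 <= b ->
  0 < vol V ->
  c * vol V <= cnt V P ->
  (forall t, t \in box V -> c / 2 * vol V <= cnt V (fun u => P (splice g t u)) ->
     b * vol V <= cnt V (fun u => P' (splice g t u))) ->
  c / 2 * b * vol V <= cnt V P'.
Proof.
move=> c0 b0 V0 cP PP'.
pose heavy t := c / 2 * vol V <= cnt V (fun u => P (splice g t u)).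
have H1 : vol V * cnt V P <= vol V * cnt V heavy + c / 2 * vol V * vol V.
  rewrite [in leLHS]cntE -(sum_splice (g := g)) //.
  have -> : vol V * cnt V heavy + c / 2 * vol V * vol V =
     \sum_(t in box V) (vol V * (heavy t)%:R + c / 2 * vol V).
    by rewrite big_split /= sum_box_const cntE mulr_sumr.
  apply: ler_sum => t tV; rewrite -cntE.
  have [ht|ht] := boolP (heavy t).
    by rewrite mulr1 (le_trans (le_cnt_vol _ _)) // lerDl mulr_ge0 ?vol_ge0 // divr_ge0.
  by rewrite mulr0 add0r ltW // ltNge.
have H2 : cnt V heavy * b * vol V <= vol V * cnt V P'.
  rewrite [in leRHS]cntE -(sum_splice (g := g)) // [in leLHS]cntE -mulrA mulr_suml.
  apply: ler_sum => t tV; rewrite -cntE.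
  have [ht|ht] := boolP (heavy t); last by rewrite mul0r cnt_ge0.
  by rewrite mul1r; apply: PP'.
have H3 : c / 2 * vol V <= cnt V heavy.
  rewrite -(ler_pM2l V0); nra.
rewrite -(ler_pM2l V0); apply: le_trans H2.
have := ler_wpM2r b0 H3 => H4.
have := ler_wpM2r (ltW V0) H4; nra.
Qed.

End Boxes.

(** * Good and null pairs of constraints *)

Definition tail_rich (R : realType) (I T : finType) (e : {ffun I -> T} -> bool)
    (z1 z2 : I) (Q : rel T) (d g : R) (V : I -> {set T}) : Prop :=
  forall X : I -> {set T}, sub_parts X V -> d * volume R V <= volume R X ->
    g * volume R V <= count_in R X (fun t => e t && Q (t z1) (t z2)).

(** The subset [G] is arbitrary because, when [f] is added, the edge [e] already present restricts
    the middle pair to a part of [Q] that depends on the other vertices of [e]. *)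
Definition head_rich (R : realType) (I T : finType) (f : {ffun I -> T} -> bool)
    (z1 z2 : I) (Q : rel T) (d g : R) (V : I -> {set T}) : Prop :=
  forall (X : I -> {set T}) (G : rel T), sub_parts X V -> subrel G Q ->
    d * volume R V <= count_in R X (fun t => G (t z1) (t z2)) ->
    g * volume R V <= count_in R X (fun t => f t && G (t z1) (t z2)).

(* The densities are those met when [e] and then [f] are added to a partial
   embedding that has density [c]. *)
Definition good_pair (R : realType) (I T : finType) (e f : {ffun I -> T} -> bool)
    (z1 z2 : I) (c g : R) (V : I -> {set T}) : Prop :=
  exists (Q : rel T) (g2 g1 : R), [/\ 0 < g2, 0 < g1,
    tail_rich e z1 z2 Q (c / 2) g2 V,
    head_rich f z1 z2 Q (c * g2 / 4) g1 V & g <= c * g2 * g1 / 4].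

Definition null_pair (R : realType) (I T : finType) (e f : {ffun I -> T} -> bool)
    (z1 z2 : I) (Q : rel T) (c : R) (V : I -> {set T}) : Prop :=
  count_in R V (fun t => e t && Q (t z1) (t z2)) <= c * volume R V /\
  count_in R V (fun t => f t && ~~ Q (t z1) (t z2)) <= c * volume R V.

Section Dichotomy.
Variables (R : realType) (I T : finType).
Implicit Types (V X Y : I -> {set T}) (t u : {ffun I -> T}).

Local Notation cnt := (count_in R).
Local Notation vol := (volume R).

Lemma cntD V (P Q : {ffun I -> T} -> bool) : (forall t, P t -> Q t) ->
  cnt V (fun t => Q t && ~~ P t) = cnt V Q - cnt V P.
Proof.
move=> PQ; apply/eqP; rewrite eq_sym subr_eq !cntE -big_split /=; apply/eqP/eq_bigr => t _.
by rewrite -natrD; case: (boolP (P t)) => [/PQ ->|]; case: (Q t).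
Qed.

Lemma sub_parts_trans X Y V : sub_parts X Y -> sub_parts Y V -> @sub_parts I T X V.
Proof. by move=> XY YV i; apply: fintype.subset_trans (XY i) (YV i). Qed.

Lemma shrinks_trans (a b : R) X Y V : 0 <= a ->
  shrinks a X Y -> shrinks b Y V -> shrinks (a * b) X V.
Proof.
move=> a0 [XY vXY] [YV vYV]; split; first exact: sub_parts_trans YV.
by rewrite -mulrA; apply: le_trans vXY; rewrite ler_wpM2l.
Qed.

(** As long as richness fails, the pairs that witness the failure are deleted from [Q]. Each round
    lowers the density of [Q] by [d], so there are at most [k] rounds; a round costs a factor [d] of
    volume and sacrifices fewer than [g0] edges with a deleted head. *)
Lemma head_cleaning (f : {ffun I -> T} -> bool) (z1 z2 : I) (d g0 : R) k :
  0 < d -> d <= 1 -> 0 <= g0 -> forall V (Q : rel T), 0 < vol V ->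
  cnt V (fun t => Q (t z1) (t z2)) <= k%:R * d * vol V ->
  exists X (Q' : rel T), [/\ shrinks (d ^+ k) X V, subrel Q' Q,
    forall Y (G : rel T), sub_parts Y X -> subrel G Q' ->
      d * vol X <= cnt Y (fun t => G (t z1) (t z2)) ->
      g0 <= cnt Y (fun t => f t && G (t z1) (t z2)) &
    cnt X (fun t => f t && (Q (t z1) (t z2) && ~~ Q' (t z1) (t z2))) <= k%:R * g0].
Proof.
move=> d0 d1 g00; elim: k => [|k IHk] V Q V0 VQ.
  exists V, Q; split => //; first by split; rewrite ?expr0 ?mul1r // => i.
    move=> Y G YV GQ; rewrite leNgt => /negP[].
    apply: le_lt_trans (mulr_gt0 d0 V0).
    rewrite mul0r mul0r in VQ; apply: le_trans VQ.
    by apply: le_cnt_sub => // t _; apply: GQ.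
  rewrite mul0r; apply: le_trans (_ : cnt V xpred0 <= _).
    by apply: le_cnt_sub => // t _ /andP[_]; rewrite andbN.
  by rewrite cntE big1.
have [rV|] := pselect (forall Y (G : rel T), sub_parts Y V -> subrel G Q ->
      d * vol V <= cnt Y (fun t => G (t z1) (t z2)) ->
      g0 <= cnt Y (fun t => f t && G (t z1) (t z2))).
  exists V, Q; split => //.
    split; first by move=> i.
    by rewrite ler_piMl ?vol_ge0 // exprn_ile1 // ltW.
  apply: le_trans (_ : cnt V xpred0 <= _).
    by apply: le_cnt_sub => // t _ /andP[_]; rewrite andbN.
  by rewrite cntE big1 // mulr_ge0.
move=> /existsNP[Y /existsNP[G /not_implyP[YV /not_implyP[GQ /not_implyP[VG]]]]].
move=> /negP; rewrite -ltNge => fG.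
(* The parts at [z1] and [z2] stay whole, so that the density of the remaining pairs is the same in
   [X0] as in [V]. The deleted pairs are in turn confined to [Y]: every tuple of [X0] over such a
   pair lies in the box of [Y], where the failure bounds the number of edges. *)
pose X0 i := if (i == z1) || (i == z2) then V i else Y i.
pose G' a b := [&& G a b, a \in Y z1 & b \in Y z2].
pose Q1 a b := Q a b && ~~ G' a b.
have YX0 : sub_parts Y X0 by move=> i; rewrite /X0; case: ifP.
have X0V : sub_parts X0 V by move=> i; rewrite /X0; case: ifP.
have vX0 : d * vol V <= vol X0.
  by apply: le_trans VG _; apply: le_trans (le_cnt_vol _ _ _) (le_vol _ YX0).
have X00 : 0 < vol X0 by apply: lt_le_trans vX0; exact: mulr_gt0.
have VQ1 : cnt V (fun t => Q1 (t z1) (t z2)) <= k%:R * d * vol V.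
  rewrite (cntD V (P := fun t => G' (t z1) (t z2)) (Q := fun t => Q (t z1) (t z2))).
    have : d * vol V <= cnt V (fun t => G' (t z1) (t z2)).
      apply: le_trans VG _; apply: le_cnt_sub => // t /in_box tY Gt.
      by rewrite /G' Gt !tY.
    by move: VQ; rewrite -natr1; lra.
  by move=> t /andP[/GQ].
have X0Q1 : cnt X0 (fun t => Q1 (t z1) (t z2)) <= k%:R * d * vol X0.
  have agree : {in [set z1; z2]%SET, X0 =1 V} by move=> i; rewrite !inE /X0 => ->.
  rewrite -(ler_pM2r V0) (cnt_agree _ _ agree); first by rewrite mulrAC ler_pM2r.
  by move=> t u tu; rewrite !tu // !inE eqxx ?orbT.
have [X [Q' [[XX0 vX] Q'Q1 HX fX]]] := IHk X0 Q1 X00 X0Q1.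
exists X, Q'; split => //.
- split; first exact: sub_parts_trans X0V.
  by rewrite exprSr -mulrA (le_trans _ vX) // ler_wpM2l // exprn_ge0 // ltW.
- by move=> a b /Q'Q1 /andP[].
- rewrite -natr1 mulrDl mul1r; apply: le_trans (lerD fX (ltW fG)).
  apply: le_trans (lerD (lexx _) (_ : cnt X (fun t => f t && G' (t z1) (t z2)) <= _)).
    apply: le_trans (cntU _ _ _ _); apply: le_cnt => t tX /andP[ft /andP[Qt nQt]].
    by rewrite tX ft /Q1 Qt nQt /=; case: (G' _ _).
  apply: le_cnt => t /in_box tX /andP[ft /and3P[Gt tz1 tz2]]; rewrite ft Gt; split => //.
  apply/in_box => i; have := fintype.subsetP (XX0 i) _ (tX i).
  by rewrite /X0; case: ifP => // /orP[] /eqP ->.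
Qed.

Lemma tail_rich_shrink (e : {ffun I -> T} -> bool) z1 z2 Q (d g th : R) X V :
  0 < th -> 0 <= g -> shrinks th X V ->
  tail_rich e z1 z2 Q d g V -> tail_rich e z1 z2 Q (d / th) g X.
Proof.
move=> th0 g0 [XV vX] rV Y YX vY.
apply: le_trans (rV Y (sub_parts_trans YX XV) _).
  by rewrite ler_wpM2l ?le_vol.
have [d0|d0] := leP 0 d; last first.
  by apply: le_trans (vol_ge0 _ _); rewrite mulr_le0_ge0 ?vol_ge0 // ltW.
apply: le_trans vY; rewrite -mulrA ler_wpM2l //.
by rewrite mulrC ler_pdivlMr // mulrC.
Qed.

Lemma head_rich_shrink (f : {ffun I -> T} -> bool) z1 z2 Q (d g th : R) X V :
  0 < th -> 0 <= g -> shrinks th X V ->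
  head_rich f z1 z2 Q d g V -> head_rich f z1 z2 Q (d / th) g X.
Proof.
move=> th0 g0 [XV vX] rV Y G YX GQ vY.
apply: le_trans (rV Y G (sub_parts_trans YX XV) GQ _).
  by rewrite ler_wpM2l ?le_vol.
have [d0|d0] := leP 0 d; last first.
  by apply: le_trans (cnt_ge0 _ _ _); rewrite mulr_le0_ge0 ?vol_ge0 // ltW.
apply: le_trans vY; rewrite -mulrA ler_wpM2l //.
by rewrite mulrC ler_pdivlMr // mulrC.
Qed.

Lemma tail_richW (e : {ffun I -> T} -> bool) z1 z2 Q (d d' g : R) V :
  d <= d' -> tail_rich e z1 z2 Q d g V -> tail_rich e z1 z2 Q d' g V.
Proof.
move=> dd' rV X XV vX; apply: rV => //; apply: le_trans vX.
by rewrite ler_wpM2r ?vol_ge0.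
Qed.

Lemma head_richW (f : {ffun I -> T} -> bool) z1 z2 Q (d d' g : R) V :
  d <= d' -> head_rich f z1 z2 Q d g V -> head_rich f z1 z2 Q d' g V.
Proof.
move=> dd' rV X G XV GQ vX; apply: rV => //; apply: le_trans vX.
by rewrite ler_wpM2r ?vol_ge0.
Qed.

Lemma good_pairW (e f : {ffun I -> T} -> bool) z1 z2 (c c' g : R) V :
  c <= c' -> good_pair e f z1 z2 c g V -> good_pair e f z1 z2 c' g V.
Proof.
move=> cc' [Q [g2 [g1 [g20 g10 re rf gc]]]]; exists Q, g2, g1; split => //.
- by apply: tail_richW re; rewrite ler_pM2r.
- by apply: head_richW rf; rewrite !ler_pM2r.
- by apply: le_trans gc _; rewrite !ler_pM2r.
Qed.

Lemma good_pair_shrink (e f : {ffun I -> T} -> bool) z1 z2 (c g th : R) X V :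
  0 < c -> 0 < th -> th <= 1 -> shrinks th X V ->
  good_pair e f z1 z2 c g V -> good_pair e f z1 z2 (c / th) g X.
Proof.
move=> c0 th0 th1 XV [Q [g2 [g1 [g20 g10 re rf gc]]]]; exists Q, g2, g1; split => //.
- by rewrite mulrAC; apply: tail_rich_shrink XV re; rewrite // ltW.
- have -> : c / th * g2 / 4 = c * g2 / 4 / th by ring.
  by apply: head_rich_shrink XV rf; rewrite // ltW.
- by apply: le_trans gc _; rewrite !ler_pM2r // ler_pdivlMr // ler_piMr // ltW.
Qed.

Lemma null_pairW (e f : {ffun I -> T} -> bool) z1 z2 Q (c c' : R) V :
  c <= c' -> null_pair e f z1 z2 Q c V -> null_pair e f z1 z2 Q c' V.
Proof.
move=> cc' [He Hf]; split; first apply: le_trans He _; last apply: le_trans Hf _.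
all: by rewrite ler_wpM2r ?vol_ge0.
Qed.

Lemma null_pair_shrink (e f : {ffun I -> T} -> bool) z1 z2 Q (c th : R) X V :
  0 <= c -> 0 < th -> shrinks th X V ->
  null_pair e f z1 z2 Q c V -> null_pair e f z1 z2 Q (c / th) X.
Proof.
move=> c0 th0 [XV vX] [He Hf].
have H : c * vol V <= c / th * vol X.
  by rewrite -mulrA ler_wpM2l // mulrC ler_pdivlMr // mulrC.
by split; [apply: le_trans (le_trans He H)|apply: le_trans (le_trans Hf H)];
  apply: le_cnt_sub.
Qed.

End Dichotomy.

(** The full relation is cleaned for heads, which leaves few heads outside [Q]. If [Q] is also rich
    in tails, the pair is good. Otherwise the box that witnesses the failure has few tails in [Q],
    and it is large enough for the heads outside [Q] to remain few there: the pair is null. *)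
Lemma pair_dichotomy (R : realType) (c : R) : 0 < c -> c <= 1 ->
  exists g th : R, [/\ 0 < g, g <= c, 0 < th, th <= 1 &
    forall (I T : finType) (e f : {ffun I -> T} -> bool) (z1 z2 : I)
      (V : I -> {set T}), 0 < volume R V ->
      exists X : I -> {set T}, shrinks th X V /\
        (good_pair e f z1 z2 c g X \/ exists Q, null_pair e f z1 z2 Q c X)].
Proof.
move=> c0 c1.
pose d2 : R := c / 2; pose g2 : R := c * d2; pose d1 : R := c * g2 / 4.
have d20 : 0 < d2 by rewrite divr_gt0.
have g20 : 0 < g2 by rewrite mulr_gt0.
have d10 : 0 < d1 by rewrite divr_gt0 // mulr_gt0.
have d21 : d2 <= 1 by rewrite /d2; lra.
have g21 : g2 <= 1 by rewrite /g2; nra.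
have d11 : d1 <= 1 by rewrite /d1; nra.
(* Enough rounds to exhaust the full relation, whose density is at most 1. *)
pose k := (Num.bound (d1^-1)).
have kd1 : 1 <= k%:R * d1.
  by rewrite -ler_pdivrMr // mul1r ltW // archi_boundP // invr_ge0 ltW.
have k0 : 0 < k%:R :> R.
  by rewrite -(pmulr_lgt0 _ d10); apply: lt_le_trans kd1.
(* [th] pays for [k] rounds of cleaning and one passage to a box of density [d2]. The edges
   sacrificed in all rounds then amount to [c * th] of the initial volume, hence to at most [c] of
   the final one. *)
pose th : R := d1 ^+ k * d2; pose g1 : R := c * th / k%:R.
have dk0 : 0 < d1 ^+ k by rewrite exprn_gt0.
have dk1 : d1 ^+ k <= 1 by rewrite exprn_ile1 // ltW.
have th0 : 0 < th by rewrite mulr_gt0.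
have th1 : th <= 1 by rewrite /th; nra.
have g10 : 0 < g1 by rewrite divr_gt0 // mulr_gt0.
have g11 : g1 <= 1.
  rewrite /g1 ler_pdivrMr // mul1r; apply: (@le_trans _ _ 1).
    by rewrite mulr_ile1 // ltW.
  apply: le_trans kd1 _; rewrite ler_piMr // ltW //.
exists (c * g2 * g1 / 4), th; split => //.
- by rewrite divr_gt0 // mulr_gt0 // mulr_gt0.
- have g21' : g2 * g1 <= 1 by rewrite mulr_ile1 // ltW.
  have -> : c * g2 * g1 / 4 = c * (g2 * g1 / 4) by ring.
  by apply: ler_piMr; [exact: ltW|rewrite ler_pdivrMr // mul1r (le_trans g21') // ler1n].
move=> I T e f z1 z2 V V0.
have [|X [Q [XV _ HX fX]]] := @head_cleaning R I T f z1 z2 d1 (g1 * volume R V) k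
  d10 d11 (mulr_ge0 (ltW g10) (ltW V0)) V (fun _ _ => true) V0.
  apply: le_trans (le_cnt_vol _ _ _) _; rewrite ler_peMl // ltW //.
have {}fX : count_in R X (fun t => f t && ~~ Q (t z1) (t z2)) <= c * th * volume R V.
  move: fX; congr (_ <= _).
  by rewrite /g1; field; rewrite gt_eqF.
have [X1V vX] := XV.
have [rX|] := pselect (tail_rich e z1 z2 Q d2 g2 X).
  exists X; split.
    split => //; apply: le_trans vX; rewrite /th ler_wpM2r ?vol_ge0 //.
    by rewrite ler_piMr // ltW.
  left; exists Q, g2, g1; split => //.
  move=> Y G YX GQ vY; apply: le_trans (HX Y G YX GQ vY).
  by rewrite ler_wpM2l ?le_vol // ltW.
move=> /existsNP[Y /not_implyP[YX /not_implyP[vY /negP]]]; rewrite -ltNge => eY.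
have vYV : th * volume R V <= volume R Y.
  apply: le_trans vY; rewrite /th mulrAC [_ * d2]mulrC ler_wpM2l // ltW //.
exists Y; split; first by split => //; exact: sub_parts_trans X1V.
right; exists Q; split.
  by apply: le_trans (ltW eY) _; rewrite -mulrA ler_wpM2l // ltW.
apply: le_trans (le_trans fX _); first exact: le_cnt_sub.
by rewrite -mulrA ler_wpM2l // ltW.
Qed.

(** * Hierarchies of thresholds along a list of blocks *)

(** [c] is the density of partial copies when the block [k] is reached and [g] the one left after
    adding it; a null block leaves [c] unchanged. The factor [lam] is a reserve: a chain with [lam]
    below 1 can afford further shrinking of the parts. *)
Fixpoint chain (R : realType) (I T : finType) (K : eqType)
    (e f : K -> {ffun I -> T} -> bool) (z1 z2 : K -> I) (Q : K -> rel T)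
    (good : pred K) (lam c : R) (ks : seq K) (V : I -> {set T}) : Prop :=
  if ks is k :: ks' then
    if good k then
      exists g : R, [/\ 0 < g, g <= c,
        good_pair (e k) (f k) (z1 k) (z2 k) (lam * c) g V &
        chain e f z1 z2 Q good lam g ks' V]
    else null_pair (e k) (f k) (z1 k) (z2 k) (Q k) (lam * c) V /\
      chain e f z1 z2 Q good lam c ks' V
  else True.

Section Chain.
Variables (R : realType) (I T : finType) (K : eqType).
Variables (e f : K -> {ffun I -> T} -> bool) (z1 z2 : K -> I).
Implicit Types (V X : I -> {set T}).

Lemma chainW (Q : K -> rel T) (good : pred K) (lam lam' c c' : R) ks V :
  0 <= lam -> lam <= lam' -> 0 <= c -> c <= c' ->
  chain e f z1 z2 Q good lam c ks V -> chain e f z1 z2 Q good lam' c' ks V.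
Proof.
move=> lam0 ll; elim: ks c c' => //= k ks IH c c' c0 cc'.
have lc : lam * c <= lam' * c' by rewrite ler_pM.
case: ifP => _ [].
  move=> g [g0 gc Hg Hks]; exists g; split => //; first exact: le_trans cc'.
    exact: good_pairW Hg.
  by apply: IH Hks; rewrite // ltW.
move=> Hn Hks; split; first exact: null_pairW Hn.
exact: IH Hks.
Qed.

Lemma chain_shrink (Q : K -> rel T) (good : pred K) (lam c th : R) ks X V :
  0 < lam -> 0 < c -> 0 < th -> th <= 1 -> shrinks th X V ->
  chain e f z1 z2 Q good lam c ks V -> chain e f z1 z2 Q good (lam / th) c ks X.
Proof.
move=> lam0 c0 th0 th1 XV; elim: ks c c0 => //= k ks IH c c0.
have lc0 : 0 < lam * c by rewrite mulr_gt0.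
case: ifP => _ [].
  move=> g [g0 gc Hg Hks]; exists g; split => //; last exact: IH.
  by rewrite mulrAC; apply: good_pair_shrink XV Hg.
move=> Hn Hks; split; last exact: IH.
by rewrite mulrAC; apply: null_pair_shrink XV Hn => //; apply: ltW.
Qed.

Lemma eq_chain (Q Q' : K -> rel T) (good good' : pred K) (lam c : R) ks V :
  {in ks, good =1 good'} -> {in ks, forall k, Q k = Q' k} ->
  chain e f z1 z2 Q good lam c ks V -> chain e f z1 z2 Q' good' lam c ks V.
Proof.
elim: ks c => //= k ks IH c gg QQ.
have {}IH c' := IH c' (fun x xs => gg x (@mem_behead _ (k :: ks) x xs))
  (fun x xs => QQ x (@mem_behead _ (k :: ks) x xs)).
rewrite -gg ?mem_head // -QQ ?mem_head //.
by case: ifP => _ [] => [g [g0 gc Hg /IH Hks]|Hn /IH]; [exists g|split].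
Qed.

End Chain.

(** The constants [g] and [th1] of the first block depend on [lam * c] only, so the other blocks can
    be prepared before it, at level [g] and with reserve [lam * th1]. The first block is treated
    last; its shrinking by [th1] brings the reserve back to [lam]. *)
Lemma chain_exists (R : realType) (K : eqType) (ks : seq K) (lam c : R) :
  uniq ks -> 0 < lam -> lam <= 1 -> 0 < c -> c <= 1 ->
  exists th : R, [/\ 0 < th, th <= 1 &
    forall (I T : finType) (e f : K -> {ffun I -> T} -> bool) (z1 z2 : K -> I)
      (V : I -> {set T}), 0 < volume R V ->
      exists (X : I -> {set T}) (Q : K -> rel T) (good : pred K),
        shrinks th X V /\ chain e f z1 z2 Q good lam c ks X].
Proof.
elim: ks lam c => [|k ks IH] lam c.
  move=> _ lam0 lam1 c0 c1; exists 1; split => // I T e f z1 z2 V _.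
  exists V, (fun=> fun _ _ => true), xpredT; split => //.
  by split; rewrite ?mul1r // => i.
move=> /= /andP[kks uks] lam0 lam1 c0 c1.
have lc0 : 0 < lam * c by rewrite mulr_gt0.
have lc1 : lam * c <= 1 by nra.
have [g [th1 [g0 gc th10 th11 H1]]] := pair_dichotomy lc0 lc1.
have gc' : g <= c by apply: le_trans gc _; rewrite ler_piMl // ltW.
have [||||th2 [th20 th21 H2]] := IH (lam * th1) g uks.
- by rewrite mulr_gt0.
- by nra.
- by [].
- exact: le_trans gc' c1.
exists (th1 * th2); split; [by rewrite mulr_gt0|by nra|].
move=> I T e f z1 z2 V V0.
have [X2 [Q [good [X2V ch2]]]] := H2 I T e f z1 z2 V V0.
have X20 : 0 < volume R X2 by case: X2V => _; apply: lt_le_trans; rewrite mulr_gt0.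
have [X1 [X1X2 gn]] := H1 I T (e k) (f k) (z1 k) (z2 k) X2 X20.
have ch1 : chain e f z1 z2 Q good lam g ks X1.
  have -> : lam = lam * th1 / th1 by rewrite mulfK // gt_eqF.
  by apply: chain_shrink ch2 => //; rewrite mulr_gt0.
have X1V : shrinks (th1 * th2) X1 V by apply: shrinks_trans X2V => //; exact: ltW.
have upd (b : bool) (q : rel T) : chain e f z1 z2 (fun k' => if k' == k then q else Q k')
    (fun k' => if k' == k then b else good k') lam g ks X1.
  by apply: eq_chain ch1 => k' k'ks; rewrite ifN //; apply: contraNneq kks => <-.
case: gn => [gp|[q nq]].
  exists X1, (fun k' => if k' == k then (fun _ _ => true) else Q k'),
    (fun k' => if k' == k then true else good k'); split => //=.
  by rewrite eqxx; exists g.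
exists X1, (fun k' => if k' == k then q else Q k'),
  (fun k' => if k' == k then false else good k'); split => //=.
rewrite eqxx; split => //.
(* The other blocks were prepared for level [g], in case [k] turned out good; their conditions only
   weaken when the level is raised to [c]. *)
by apply: chainW (upd false q) => //; apply: ltW.
Qed.

Lemma chain_null (R : realType) (I T : finType) (K : eqType)
    (e f : K -> {ffun I -> T} -> bool) (z1 z2 : K -> I) (Q : K -> rel T)
    (good : pred K) (c : R) (ks : seq K) (V : I -> {set T}) k :
  0 < c -> chain e f z1 z2 Q good 1 c ks V -> k \in ks -> ~~ good k ->
  null_pair (e k) (f k) (z1 k) (z2 k) (Q k) c V.
Proof.
elim: ks c => //= k' ks IH c c0 H; rewrite inE => /predU1P[->|kks] gk.
  by move: H; rewrite (negPf gk) mul1r => -[].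
move: H; case: ifP => _ [].
  move=> g [g0 gc _ Hks]; apply: null_pairW gc _; exact: IH.
by move=> _ Hks; exact: IH.
Qed.

(** * Embedding along good pairs *)

Definition maps_edge (I T : finType) (E : {set {set T}}) (g : {set I})
    (t : {ffun I -> T}) : bool :=
  [set t i | i in g]%SET \in E.

Section Embedding.
Variables (R : realType) (I T : finType) (E : {set {set T}}).
Implicit Types (V X : I -> {set T}) (t u : {ffun I -> T}) (g : {set I}).

Local Notation cnt := (count_in R).
Local Notation vol := (volume R).

Lemma maps_edge_depends g : depends_on g (maps_edge E g).
Proof.
by move=> t u tu; rewrite /maps_edge; rewrite (finset.eq_in_imset tu).
Qed.

Lemma cnt_gt0 V P : 0 < cnt V P -> exists t, t \in box V /\ P t.
Proof.
move=> PV; have [/existsP[t /andP[tV Pt]]|] := boolP [exists t, (t \in box V) && P t].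
  by exists t.
rewrite negb_exists => /forallP nP; move: PV.
by rewrite /count_in big_pred0 ?ltxx // => t; apply/negbTE/nP.
Qed.

Lemma cards_le1_eq (U : finType) (A : {set U}) x y :
  (#|A| <= 1)%N -> x \in A -> y \in A -> x = y.
Proof. by move=> /card_le1_eqP A1 xA yA; exact: (A1 y x yA xA). Qed.

(* Edges meeting [g0] in at most one vertex constrain the vertices of [g0]
   independently of each other. *)
Lemma resample_parts V (Es : seq {set I}) (g0 : {set I}) t :
  (forall g, g \in Es -> #|g :&: g0| <= 1)%N ->
  exists X, [/\ sub_parts X V,
    (forall u, u \in box V -> all (fun g => maps_edge E g (splice g0 t u)) Es ->
       u \in box X) &
    (forall u0, all (fun g => maps_edge E g (splice g0 t u0)) Es ->
       forall u, u \in box X -> all (fun g => maps_edge E g (splice g0 t u)) Es)].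
Proof.
move=> Es1.
have agree i g u : g \in Es -> i \in g -> i \in g0 ->
    maps_edge E g (splice g0 t u) = maps_edge E g (splice [set i]%SET t [ffun=> u i]).
  move=> gEs ig ig0; apply: maps_edge_depends => j jg; rewrite !ffunE inE.
  have [jg0|jg0] := boolP (j \in g0).
    have -> : j = i by apply: (cards_le1_eq (Es1 g gEs)); rewrite !inE ?jg ?ig.
    by rewrite eqxx.
  by rewrite ifN //; apply: contraNneq jg0 => ->.
(* A part in [g0] keeps the vertices accepted by all edges through it, the other vertices of these
   edges being those of [t]. *)
pose X i := if i \in g0 then [set v in V i | all (fun g => (i \in g) ==>
  maps_edge E g (splice [set i]%SET t [ffun=> v])) Es]%SET else V i.
have XV : sub_parts X V.
  move=> i; rewrite /X; case: ifP => // _.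
  by apply/fintype.subsetP => v; rewrite inE => /andP[].
exists X; split => //.
  move=> u /in_box uV /allP uEs; apply/in_box => i; rewrite /X; case: ifP => // ig0.
  rewrite inE uV /=; apply/allP => g gEs; apply/implyP => ig.
  by rewrite -agree // uEs.
move=> u0 /allP u0Es u /in_box uX; apply/allP => g gEs.
have [/eqP|/set0Pn[i]] := boolP (g :&: g0 == finset.set0).
  (* An edge disjoint from [g0] depends on [t] alone; that it is mapped to an edge is certified by
     the one known resampling [u0]. *)
  move=> /setP gg0; rewrite (maps_edge_depends (u := splice g0 t u0)) ?u0Es // => j jg.
  by have := gg0 j; rewrite !inE jg !ffunE => /= ->.
rewrite inE => /andP[ig ig0]; rewrite (agree i) //.
have := uX i; rewrite /X ig0 inE => /andP[_ /allP /(_ _ gEs)].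
by rewrite ig.
Qed.

(** Two resamplings. The one over [e] uses tail richness and keeps the middle pair inside [Q], which
    is what lets head richness act in the one over [f]. The density goes from [c] to [c * g2 / 2]
    and then to [c * g2 * g1 / 4]. *)
Lemma embed_step V (Es : seq {set I}) (e f : {set I}) z1 z2 (c g : R) :
  0 < vol V -> 0 < c ->
  z1 \in e -> z2 \in e -> z1 \in f -> z2 \in f -> e :&: f \subset [set z1; z2]%SET ->
  (forall g', g' \in Es -> #|g' :&: e| <= 1)%N ->
  (forall g', g' \in Es -> #|g' :&: f| <= 1)%N ->
  good_pair (maps_edge E e) (maps_edge E f) z1 z2 c g V ->
  c * vol V <= cnt V (fun t => all (fun g' => maps_edge E g' t) Es) ->
  g * vol V <= cnt V (fun t => all (fun g' => maps_edge E g' t) [:: e, f & Es]).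
Proof.
move=> V0 c0 z1e z2e z1f z2f efz Ese Esf [Q [g2 [g1 [g20 g10 re rf gc]]]] W0.
pose W t := all (fun g' => maps_edge E g' t) Es.
pose W1 t := [&& W t, maps_edge E e t & Q (t z1) (t z2)].
have H1 : c / 2 * g2 * vol V <= cnt V W1.
  apply: (cnt_resample (g := e) _ _ V0 W0); [exact: ltW|exact: ltW|].
  move=> t tV Wt; have [X [XV VX H]] := resample_parts V t Ese.
  have [u0 [_ Wu0]] : exists u, u \in box V /\ W (splice e t u).
    by apply: cnt_gt0; apply: lt_le_trans Wt; rewrite mulr_gt0 // divr_gt0.
  apply: le_trans (re X XV _) _.
    apply: le_trans Wt _; apply: le_cnt => u uV Wu; split => //; exact: VX.
  apply: le_cnt => u uX /andP[eu Qu]; split; first exact: sub_box uX.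
  apply/and3P; split; first exact: (H u0 Wu0 u uX).
    rewrite (maps_edge_depends (u := u)) // => i ie; by rewrite ffunE ie.
  by rewrite !ffunE z1e z2e.
have -> : (fun t => all (fun g' => maps_edge E g' t) [:: e, f & Es]) =
   fun t => [&& maps_edge E e t, maps_edge E f t & W t] by [].
have H2 : c / 2 * g2 / 2 * g1 * vol V <= cnt V (fun t => W1 t && maps_edge E f t).
  have c20 : 0 < c / 2 * g2 by rewrite mulr_gt0 // divr_gt0.
  apply: (cnt_resample (g := f) _ _ V0 H1); [exact: ltW|exact: ltW|].
  move=> t tV Wt; have [X [XV VX H]] := resample_parts V t Esf.
  have [u0 [_ /andP[Wu0 _]]] : exists u, u \in box V /\ W1 (splice f t u).
    by apply: cnt_gt0; apply: lt_le_trans Wt; rewrite mulr_gt0 // divr_gt0.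
  (* With the vertices outside [f] frozen, [e] sees only the middle pair, since [e] and [f] share
     nothing else. The survival of [e] is therefore a subrelation of [Q]. *)
  pose G a b := Q a b &&
    maps_edge E e [ffun i => if i == z1 then a else if i == z2 then b else t i].
  have eG u : maps_edge E e (splice f t u) =
     maps_edge E e [ffun i => if i == z1 then u z1 else if i == z2 then u z2 else t i].
    apply: maps_edge_depends => i ie; rewrite !ffunE.
    have [iF|iF] := boolP (i \in f).
      have := fintype.subsetP efz i; rewrite !inE ie iF => /(_ isT).
      by case: eqP => [->|_] //= /eqP ->; rewrite eqxx.
    rewrite !ifN //; first by apply: contraNneq iF => ->.
    by apply: contraNneq iF => ->.
  apply: le_trans (rf X G XV _ _) _; first by move=> a b /andP[].
    have -> : c * g2 / 4 = c / 2 * g2 / 2 by field.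
    apply: le_trans Wt _; apply: le_cnt => u uV /and3P[Wu eu].
    rewrite !ffunE z1f z2f => Qu; split; first exact: VX.
    by rewrite /G Qu -eG.
  apply: le_cnt => u uX /andP[fu /andP[Qu eu]]; split; first exact: sub_box uX.
  rewrite /W1 /W eG eu !ffunE z1f z2f Qu (H u0 Wu0 u uX) /=.
  by rewrite (maps_edge_depends (u := u)) // => i iF; rewrite ffunE iF.
apply: le_trans (_ : c / 2 * g2 / 2 * g1 * vol V <= _).
  rewrite ler_wpM2r ?vol_ge0 //; apply: le_trans gc _.
  by rewrite le_eqVlt; apply/orP; left; apply/eqP; field.
apply: le_trans H2 _; apply: le_cnt => t tV /andP[/and3P[Wt et _] ft].
by rewrite et ft.
Qed.

(** [sel] marks the blocks that carry a twin pair of the hypergraph to embed. The other blocks of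
    the list are passed over; if good, they merely weaken the density bound from [c] to [g]. *)
Lemma embed_chain (K : eqType) (e f : K -> {set I}) (z1 z2 : K -> I) (Q : K -> rel T)
    (good sel : pred K) (ks : seq K) (c : R) (Es : seq {set I}) V :
  0 < vol V -> 0 < c -> uniq ks ->
  {in ks, forall k, sel k -> good k} ->
  {in ks, forall k, sel k -> [/\ z1 k \in e k :&: f k, z2 k \in e k :&: f k &
     e k :&: f k \subset [set z1 k; z2 k]%SET]} ->
  {in Es & ks, forall g k, sel k -> (#|g :&: e k| <= 1)%N /\ (#|g :&: f k| <= 1)%N} ->
  {in ks &, forall k k', sel k -> sel k' -> k != k' ->
     forall g, g \in [:: e k; f k] -> (#|g :&: e k'| <= 1)%N /\ (#|g :&: f k'| <= 1)%N} ->
  chain (fun k => maps_edge E (e k)) (fun k => maps_edge E (f k)) z1 z2 Q good 1 c ks V ->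
  c * vol V <= cnt V (fun t => all (fun g => maps_edge E g t) Es) ->
  exists t, [/\ t \in box V, all (fun g => maps_edge E g t) Es &
    {in ks, forall k, sel k -> maps_edge E (e k) t /\ maps_edge E (f k) t}].
Proof.
move=> V0; elim: ks c Es => [|k ks IH] c Es c0.
  move=> _ _ _ _ _ _ cW.
  have [t [tV Wt]] : exists t, t \in box V /\ all (fun g => maps_edge E g t) Es.
    by apply: cnt_gt0; apply: lt_le_trans cW; rewrite mulr_gt0.
  by exists t.
move=> /= /andP[kks uks] sg Hz HEs Hks Hch cW.
have ksk k' : k' \in ks -> k' \in k :: ks by rewrite inE orbC => ->.
have kk : k \in k :: ks by rewrite mem_head.
have sg' : {in ks, forall k, sel k -> good k} by move=> k' /ksk; apply: sg.
have Hz' : {in ks, forall k, sel k -> [/\ z1 k \in e k :&: f k, z2 k \in e k :&: f k &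
     e k :&: f k \subset [set z1 k; z2 k]%SET]} by move=> k' /ksk; apply: Hz.
have Hks' : {in ks &, forall k k', sel k -> sel k' -> k != k' ->
     forall g, g \in [:: e k; f k] -> (#|g :&: e k'| <= 1)%N /\ (#|g :&: f k'| <= 1)%N}.
  by move=> k1 k2 /ksk k1s /ksk k2s; apply: Hks.
have HEs' : {in Es & ks, forall g k, sel k -> (#|g :&: e k| <= 1)%N /\ (#|g :&: f k| <= 1)%N}.
  by move=> g k' gEs /ksk; apply: HEs.
have [sk|nsk] := boolP (sel k); last first.
  have [g [g0 gc ch]] : exists g : R, [/\ 0 < g, g <= c &
      chain (fun k => maps_edge E (e k)) (fun k => maps_edge E (f k)) z1 z2 Q good 1 g ks V].
    by move: Hch; case: ifP => _ [] => [g [g0 gc _ ch]|_ ch]; [exists g|exists c].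
  have gW : g * vol V <= cnt V (fun t => all (fun g => maps_edge E g t) Es).
    by apply: le_trans cW; rewrite ler_wpM2r // ltW.
  have [t [tV tEs tks]] := IH g Es g0 uks sg' Hz' HEs' Hks' ch gW.
  exists t; split => // k'; rewrite inE => /predU1P[->|/tks //].
  by rewrite (negPf nsk).
move: Hch; rewrite (sg k kk sk) => -[g [g0 gc]]; rewrite mul1r => gp ch.
have [] := Hz k kk sk; rewrite !inE => /andP[z1e z1f] /andP[z2e z2f] efz.
have gW : g * vol V <= cnt V (fun t => all (fun g => maps_edge E g t) [:: e k, f k & Es]).
  apply: embed_step gp cW => // g' g'Es; first by have [] := HEs g' k g'Es kk sk.
  by have [] := HEs g' k g'Es kk sk.
have [|t [tV /and3P[te tf tEs] tks]] := IH g [:: e k, f k & Es] g0 uks sg' Hz' _ Hks' ch gW.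
  move=> g' k'; rewrite -cat1s -(cat1s (f k)) catA mem_cat => /orP[].
    move=> g'k k'ks sk'; apply: (Hks k k') => //; first exact: ksk.
    by apply: contraNneq kks => ->.
  by move=> g'Es k'ks; apply: HEs'.
by exists t; split => // k'; rewrite inE => /predU1P[->|/tks].
Qed.

End Embedding.

(** * Equalizing and refining the parts *)

Lemma subset_of_card (T : finType) (A : {set T}) n :
  (n <= #|A|)%N -> exists B : {set T}, B \subset A /\ #|B| = n.
Proof.
move=> nA; exists [set x in take n (enum A)]%SET; split.
  by apply/fintype.subsetP => x; rewrite inE => /mem_take; rewrite mem_enum.
by rewrite cardsE (card_uniqP _) ?take_uniq ?enum_uniq // size_takel // -cardE.
Qed.

Definition set_part (I T : finType) (V : I -> {set T}) (i : I) (A : {set T}) : I -> {set T} :=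
  fun j => if j == i then A else V j.

Section Counting.
Variables (R : realType) (I T : finType).
Implicit Types (V X : I -> {set T}) (t u : {ffun I -> T}).

Local Notation cnt := (count_in R).
Local Notation vol := (volume R).

Lemma vol_set_part V i (A : {set T}) :
  vol (set_part V i A) * #|V i|%:R = #|A|%:R * vol V.
Proof.
rewrite !volE !(bigD1 (P := xpredT) i) //= /set_part eqxx.
have -> : \prod_(j | j != i) #|if j == i then A else V j|%:R =
  \prod_(j | j != i) #|V j|%:R :> R by apply: eq_bigr => j /negPf ->.
by ring.
Qed.

Lemma sub_set_part V i (A : {set T}) : A \subset V i -> sub_parts (set_part V i A) V.
Proof. by move=> AV j; rewrite /set_part; case: eqP => // ->. Qed.

Lemma cnt_set_part V i (A : {set T}) (P : {ffun I -> T} -> bool) : A \subset V i ->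
  cnt (set_part V i A) P = cnt V (fun t => P t && (t i \in A)).
Proof.
move=> AV; rewrite /count_in; apply: eq_bigl => t; apply/andP/andP => -[].
  move=> tX Pt; rewrite Pt; split; first exact: sub_box (sub_set_part AV) tX.
  by have /in_box/(_ i) := tX; rewrite /set_part eqxx.
move=> /in_box tV /andP[Pt tA]; split => //; apply/in_box => j.
by rewrite /set_part; case: eqP => // ->.
Qed.

Lemma cnt_coord V i (Y : pred T) :
  cnt V (fun t => Y (t i)) * #|V i|%:R = #|[set a in V i | Y a]%SET|%:R * vol V.
Proof.
rewrite -(vol_set_part V i); congr (_ * _); rewrite /volume cnt_set_part; last first.
  by apply/fintype.subsetP => a; rewrite inE => /andP[].
by apply: eq_cnt => t /in_box tV; rewrite !inE tV.
Qed.

(** Only the coordinate [i] is resampled, and the degree bound holds for each vertex of [V j]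
    separately. The event [W] may thus depend on the coordinate [j], as it does when head and tail
    of an edge overlap. *)
Lemma cnt_coord_le V i j (W : {ffun I -> T} -> bool) (Pr : rel T) (p : R) :
  0 < vol V -> i != j -> depends_on [set~ i]%SET W ->
  (forall x, x \in V j -> #|[set a in V i | Pr a x]%SET|%:R <= p * #|V i|%:R) ->
  cnt V (fun t => W t && Pr (t i) (t j)) <= p * cnt V W.
Proof.
move=> V0 ij dW HP.
rewrite -(ler_pM2l V0) [in leLHS]cntE -(sum_splice (g := [set i]%SET)) //.
rewrite mulrCA mulrA [p * _]mulrC [in leRHS]cntE mulr_sumr.
apply: ler_sum => t /in_box tV; rewrite -cntE.
have -> : cnt V (fun u => W (splice [set i]%SET t u) &&
    Pr (splice [set i]%SET t u i) (splice [set i]%SET t u j)) =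
    cnt V (fun u => W t && Pr (u i) (t j)).
  apply: eq_cnt => u _; rewrite !ffunE !inE eqxx eq_sym (negPf ij); congr (_ && _).
  by apply: dW => k; rewrite !inE ffunE inE => /negPf ->.
case: (W t) => /=; last by rewrite mulr0 cntE big1.
have Vi0 : 0 < #|V i|%:R :> R by rewrite ltr0n card_gt0 (vol_neq0 V0).
rewrite mulr1 -(ler_pM2r Vi0) (cnt_coord V i (fun a => Pr a (t j))).
by rewrite mulrC -mulrA ler_pM2l // HP.
Qed.

(** Deleting from a part a vertex whose share of [P] is at least the average does not raise the
    density of [P]; this is repeated until all parts have size [s]. *)
Lemma equalize V (P : {ffun I -> T} -> bool) s : (0 < s)%N ->
  (forall i, s <= #|V i|)%N ->
  exists X, [/\ sub_parts X V, forall i, #|X i| = s & cnt X P * vol V <= cnt V P * vol X].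
Proof.
move=> s0; have [n] := ubnP (\sum_i (#|V i| - s))%N.
elim: n V => // n IH V Vn sV.
have [/forallP Vs|] := boolP [forall i, #|V i| == s].
  by exists V; split => // i; apply/eqP.
rewrite negb_forall => /existsP[i Vis].
have sVi : (s < #|V i|)%N by rewrite ltn_neqAle eq_sym Vis sV.
have Vi0 : 0 < #|V i|%:R :> R by rewrite ltr0n; apply: leq_ltn_trans sVi.
have [x [xV Hx]] : exists x, x \in V i /\
    cnt V P <= cnt V (fun t => P t && (t i == x)) * #|V i|%:R.
  apply/not_existsP => H.
  have H1 : \sum_(x in V i) cnt V (fun t => P t && (t i == x)) = cnt V P.
    rewrite cntE; under eq_bigr do rewrite cntE.
    rewrite exchange_big /=; apply: eq_bigr => t /in_box tV.
    rewrite (bigD1 (t i)) //= eqxx andbT big1 ?addr0 // => x /andP[_ xt].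
    by rewrite eq_sym (negPf xt) andbF.
  have [x0 x0V] : exists x0, x0 \in V i by apply/card_gt0P; apply: leq_ltn_trans sVi.
  have : \sum_(x in V i) cnt V (fun t => P t && (t i == x)) * #|V i|%:R
     < \sum_(x in V i) cnt V P.
    apply: ltr_sum; first by apply/hasP; exists x0; rewrite // mem_index_enum.
    move=> x xV; rewrite ltNge; apply/negP => Hx; by apply: (H x); split.
  by rewrite -mulr_suml H1 mulr_natr sumr_const ltxx.
have VxV : V i :\ x \subset V i by rewrite subD1set.
have cVx : #|V i :\ x| = #|V i|.-1 by rewrite (cardsD1 x (V i)) xV.
have [||X [XV Xs HX]] := IH (set_part V i (V i :\ x)%SET).
- rewrite -ltnS; apply: leq_trans Vn; rewrite ltnS.
  have -> : (\sum_j (#|set_part V i (V i :\ x)%SET j| - s) =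
    (#|V i|.-1 - s) + \sum_(j | j != i) (#|V j| - s))%N.
    rewrite (bigD1 i) //= {1}/set_part eqxx cVx; congr (_ + _)%N.
    by apply: eq_bigr => j ji; rewrite /set_part (negPf ji).
  by rewrite [X in (_ < X)%N](bigD1 i) //= ltn_add2r; lia.
- by move=> j; rewrite /set_part; case: eqP => // _; rewrite cVx; lia.
exists X; split => //; first exact: sub_parts_trans (sub_set_part VxV).
have H1 : cnt (set_part V i (V i :\ x)%SET) P = cnt V P - cnt V (fun t => P t && (t i == x)).
  rewrite cnt_set_part // -cntD; last by move=> t /andP[].
  apply: eq_cnt => t /in_box tV; rewrite !inE tV andbT.
  by case: (P t) => //=; case: (t i == x).
have := vol_set_part V i (V i :\ x)%SET.
have -> : #|(V i :\ x)%SET|%:R = #|V i|%:R - 1 :> R by rewrite cVx -subn1 natrB //; lia.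
move=> H2.
have Vi1 : 0 < #|V i|%:R - 1 :> R by rewrite subr_gt0 ltr1n; lia.
rewrite -(ler_pM2r Vi1) -mulrA [vol V * _]mulrC -H2 mulrA mulrAC.
apply: le_trans (_ : cnt (set_part V i (V i :\ x)%SET) P * vol X * #|V i|%:R <= _).
  by rewrite mulrAC ler_pM2r.
rewrite H1 mulrAC [leRHS]mulrAC ler_wpM2r ?vol_ge0 //.
by rewrite mulrBl mulrBr mulr1 lerB.
Qed.

End Counting.

Lemma pigeonhole (T C : finType) (A : {set T}) (f : T -> C) s :
  (0 < #|C|)%N -> (s * #|C| <= #|A|)%N -> exists c, (s <= #|[set x in A | f x == c]%SET|)%N.
Proof.
move=> C0 sA; apply/not_existsP => H.
have cA : (\sum_c #|[set x in A | f x == c]%SET| = #|A|)%N.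
  rewrite -sum1_card (partition_big f xpredT) //=; apply: eq_bigr => c _.
  by rewrite -sum1_card; apply: eq_bigl => x; rewrite inE.
have : (\sum_c #|[set x in A | f x == c]%SET| <= \sum_(c : C) s.-1)%N.
  by apply: leq_sum => c _; move/negP: (H c); rewrite -ltnNge; case: (s).
have [/card_gt0P[c0 _] s0] : (0 < #|C|)%N /\ (0 < s)%N.
  split => //; rewrite lt0n; apply/negP => /eqP s0.
  by have /card_gt0P[c _] := C0; apply: (H c); rewrite s0.
rewrite cA sum_nat_const => H1; have : (#|C| * s.-1 < #|C| * s)%N by rewrite ltn_pmul2l // prednK.
by rewrite ltnNge mulnC => /negP[]; apply: leq_trans H1.
Qed.

(* The parts are treated in increasing order, so that the degrees of a vertex
   into the earlier parts are already final when its own part is refined. *)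
Lemma bucket (M : nat) (T : finType) (C : 'I_M -> 'I_M -> rel T) q s (V : 'I_M -> {set T}) :
  (0 < s)%N -> (forall i, #|V i| = s * q.+1 ^ M)%N ->
  exists X, [/\ sub_parts X V, forall i, #|X i| = s &
    forall i j : 'I_M, (i < j)%N -> exists b : 'I_q.+1, forall x, x \in X j ->
      (b * s <= q * #|[set a in X i | C i j a x]%SET| < b.+1 * s)%N].
Proof.
move=> s0 Vs.
have sV i : (s <= #|V i|)%N by rewrite Vs leq_pmulr // expn_gt0.
suff H k : (k <= M)%N -> exists X, [/\ sub_parts X V, forall i : 'I_M, (i < k)%N -> #|X i| = s,
    forall i : 'I_M, (k <= i)%N -> X i = V i &
    forall i j : 'I_M, (i < j)%N -> (j < k)%N -> exists b : 'I_q.+1, forall x, x \in X j ->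
      (b * s <= q * #|[set a in X i | C i j a x]%SET| < b.+1 * s)%N].
  have [X [XV Xs _ HX]] := H M (leqnn M).
  by exists X; split => // i; [rewrite Xs|move=> j ij; apply: HX].
elim: k => [|k IH] kM; first by exists V; split.
have [X [XV Xs XVk HX]] := IH (ltnW kM).
pose j0 := Ordinal kM.
pose deg (i : 'I_M) x := (q * #|[set a in X i | C i j0 a x]%SET| %/ s)%N.
(* The vector of degree buckets takes at most [q.+1 ^ M] values, which is the factor by which the
   sizes of the parts exceed [s]. *)
pose f x : {ffun 'I_M -> 'I_q.+1} := [ffun i => inord (deg i x)].
have [||c Hc] := @pigeonhole T {ffun 'I_M -> 'I_q.+1} (V j0) f s.
- by rewrite card_ffun !card_ord expn_gt0.
- by rewrite card_ffun !card_ord Vs.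
have [Y [YV Ys]] := subset_of_card Hc.
have YVj : Y \subset V j0.
  by apply: fintype.subset_trans YV _; apply/fintype.subsetP => x; rewrite inE => /andP[].
have Xj0 (i : 'I_M) : (i < k)%N -> set_part X j0 Y i = X i.
  by rewrite /set_part; case: eqP => // ->; rewrite ltnn.
exists (set_part X j0 Y); split.
- by move=> i; rewrite /set_part; case: eqP => // ->.
- move=> i; rewrite ltnS leq_eqVlt => /predU1P[ik|ik]; last by rewrite Xj0 // Xs.
  by rewrite /set_part ifT //; apply/eqP/val_inj.
- move=> i ki; rewrite /set_part ifN ?XVk //; first exact: ltnW.
  by apply: contraTneq ki => ->; rewrite ltnn.
- move=> i j ij; rewrite ltnS leq_eqVlt => /predU1P[jk|jk]; last first.
    by rewrite !Xj0 //; [apply: HX|apply: ltn_trans jk].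
  have -> : j = j0 by apply: val_inj.
  have ik : (i < k)%N by rewrite -jk.
  exists (c i) => x; rewrite (Xj0 i) // {1}/set_part eqxx => /(fintype.subsetP YV).
  rewrite inE => /andP[_ /eqP fx].
  have -> : nat_of_ord (c i) = deg i x.
    rewrite -fx ffunE inordK // ltnS /deg.
    have : (#|[set a in X i | C i j0 a x]%SET| <= s)%N.
      rewrite -(Xs i ik); apply: subset_leq_card.
      by apply/fintype.subsetP => a; rewrite inE => /andP[].
    move=> H; apply: (@leq_trans (q * s %/ s)); last by rewrite mulnK.
    by apply: leq_div2r; rewrite leq_mul2l H orbT.
  by rewrite /deg leq_divM ltn_ceil.
Qed.

(** * Transversal sets in disjoint parts of equal size *)

Section Transversals.
Variables (R : realType) (I T : finType) (V : I -> {set T}) (s : nat).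
Implicit Types (t u : {ffun I -> T}) (A : {set I}).

Local Notation cnt := (count_in R).
Local Notation vol := (volume R).

Hypothesis disjV : forall i j x, x \in V i -> x \in V j -> i = j.
Hypothesis cardV : forall i, #|V i| = s.
Hypothesis s_gt0 : (0 < s)%N.

Lemma vol_uniform : vol V = s%:R ^+ #|I|.
Proof. by rewrite volE (eq_bigr (fun=> s%:R)) ?prodr_const // => i _; rewrite cardV. Qed.

Lemma mem_transversal t A i x : t \in box V ->
  x \in [set t j | j in A]%SET -> x \in V i -> i \in A /\ x = t i.
Proof.
move=> /in_box tV /imsetP[j jA ->] tjV.
by have <- := disjV (tV j) tjV.
Qed.

Lemma card_transversal t A : t \in box V -> #|[set t j | j in A]%SET| = #|A|.
Proof.
move=> /in_box tV; apply: card_in_imset => i j _ _ tij.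
by apply: (disjV (tV i)); rewrite tij.
Qed.

(** The parts being disjoint, a transversal set determines the coordinates in [A], and each other
    coordinate has [s] values. *)
Lemma cnt_transversal A (P : pred {set T}) :
  cnt V (fun t => P [set t j | j in A]%SET) <=
  #|[set [set t j | j in A]%SET | t : {ffun I -> T} in
      [set t in box V | P [set t j | j in A]%SET]]%SET|%:R
    * s%:R ^+ #|~: A|.
Proof.
set D := [set t in box V | _]%SET.
have -> : cnt V (fun t => P [set t j | j in A]%SET) = \sum_(t in D) 1.
  by rewrite /count_in; apply: eq_bigl => t; rewrite [RHS]inE.
rewrite (partition_big_imset (fun t : {ffun I -> T} => [set t j | j in A]%SET)) /=.
apply: le_trans (_ : \sum_(E in [set [set t j | j in A]%SET | t : {ffun I -> T} in D]%SET)
  s%:R ^+ #|~: A| <= _);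
  last by rewrite sumr_const mulr_natl.
apply: ler_sum => E /imsetP[t0]; rewrite inE => /andP[t0V _] ->.
pose X i := if i \in A then [set t0 i]%SET else V i.
have -> : s%:R ^+ #|~: A| = vol X.
  rewrite volE (bigID (mem A)) /= big1 ?mul1r; last first.
    by move=> i iA; rewrite /X iA cards1.
  rewrite (eq_bigr (fun=> s%:R)); last by move=> i /negPf iA; rewrite /X iA cardV.
  by rewrite prodr_const; congr (_ ^+ _); apply: eq_card => i; rewrite !inE.
rewrite /volume /count_in [leRHS]big_mkcond [leLHS]big_mkcond; apply: ler_sum => t _.
case: ifP => [/andP[]|_]; last by case: ifP.
rewrite inE => /andP[tV _] /eqP tt0; rewrite ifT //; rewrite andbT.
apply/in_box => i; rewrite /X; case: ifP => iA; last by move/in_box: tV.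
have : t i \in [set t0 j | j in A]%SET by rewrite -tt0 imset_f.
move=> /mem_transversal /(_ (in_box V t tV i)) [] //= _ ->; rewrite ?inE //.
Qed.

Lemma in_union_parts (J : {set I}) x :
  reflect (exists2 i, i \in J & x \in V i) (x \in [set x | [exists i in J, x \in V i]]%SET).
Proof.
rewrite inE; apply: (iffP existsP) => [[i /andP[iJ xV]]|[i iJ xV]]; exists i => //.
by rewrite iJ.
Qed.

Lemma card_union_parts (J : {set I}) :
  #|[set x | [exists i in J, x \in V i]]%SET| = (#|J| * s)%N.
Proof.
rewrite -sum1_card.
transitivity (\sum_(i in J) \sum_(x in V i) 1)%N; last first.
  by rewrite (eq_bigr (fun=> s)) ?sum_nat_const // => i _; rewrite sum1_card.
under [RHS]eq_bigr => i _ do rewrite big_mkcond /=.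
rewrite exchange_big /= big_mkcond; apply: eq_bigr => x _.
case: in_union_parts => [[i iJ xV]|nS].
  rewrite (bigD1 i) //= xV big1 ?addn0 // => j /andP[jJ ji].
  by rewrite ifN //; apply: contraNN ji => xVj; rewrite (disjV xVj xV).
by rewrite big1 // => i iJ; rewrite ifN //; apply/negP => xV; apply: nS; exists i.
Qed.

Lemma edges_le_transversals (E : {set {set T}}) (J : {set I}) (r : nat) (p : R) :
  (forall A, A \subset J -> #|A| = r -> cnt V (maps_edge E A) <= p * vol V) ->
  #|[set e in E | (#|e| == r) && (e \subset [set x | [exists i in J, x \in V i]]%SET)]%SET|%:R
    + (1 - p) * 'C(#|J|, r)%:R * s%:R ^+ r <= 'C(#|J| * s, r)%:R.
Proof.
move=> HE.
pose S : {set T} := [set x | [exists i in J, x \in V i]]%SET; rewrite -/S.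
set ES := [set e in E | _]%SET.
have SP := in_union_parts J; rewrite -/S in SP.
have cS : #|S| = (#|J| * s)%N by exact: card_union_parts.
pose D := [set e : {set T} | (e \subset S) && (#|e| == r)]%SET.
have cD : #|D| = 'C(#|J| * s, r) by rewrite cards_draws cS.
pose idx (e : {set T}) := [set i | e :&: V i != finset.set0]%SET.
pose NE A := [set [set t j | j in A]%SET | t : {ffun I -> T} in
  [set t in box V | [set t j | j in A]%SET \notin E]]%SET.
have cNE A : A \subset J -> #|A| = r -> (1 - p) * s%:R ^+ r <= #|NE A|%:R.
  move=> AJ Ar; have := cnt_transversal A (fun e => e \notin E).
  rewrite (cntC R V (fun t => maps_edge E A t)) => H.
  have s0 : 0 < s%:R ^+ #|~: A| :> R by rewrite exprn_gt0 // ltr0n.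
  rewrite -(ler_pM2r s0); apply: le_trans H.
  have := HE A AJ Ar; rewrite vol_uniform -(cardsC A) Ar exprD; lra.
have NED A e : A \subset J -> #|A| = r -> e \in NE A ->
    [/\ e \in D, e \notin E & idx e = A].
  move=> AJ Ar /imsetP[t]; rewrite inE => /andP[tV tE] ->; split => //.
    rewrite inE card_transversal // Ar eqxx andbT; apply/fintype.subsetP => x /imsetP[i iA ->].
    by apply/SP; exists i; [exact: (fintype.subsetP AJ)|exact/in_box].
  apply/setP => i; rewrite inE; apply/set0Pn/idP => [[x]|iA].
    by rewrite inE => /andP[xA xV]; have [] := mem_transversal tV xA xV.
  by exists (t i); rewrite inE imset_f //; apply/in_box.
have H1 : (\sum_(A : {set I} | (A \subset J) && (#|A| == r)) #|NE A| + #|ES| <= #|D|)%N.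
  rewrite -(cardsID E D) addnC leq_add //.
    by apply: subset_leq_card; apply/fintype.subsetP => e; rewrite !inE => /and3P[-> -> ->].
  rewrite -[leqRHS]sum1_card (partition_big idx xpredT) //= [leqLHS]big_mkcond.
  apply: leq_sum => A _; case: ifP => // /andP[AJ /eqP Ar].
  rewrite -sum1_card [leqLHS]big_mkcond [leqRHS]big_mkcond; apply: leq_sum => e _.
  case: ifP => // eNE; have [eD eE eA] := NED A e AJ Ar eNE.
  by rewrite inE eD eE eA eqxx.
rewrite -cD; move: H1; rewrite -(ler_nat R) natrD addrC; apply: le_trans.
rewrite lerD2l natr_sum -mulrA mulrCA.
apply: le_trans (_ : \sum_(A : {set I} | (A \subset J) && (#|A| == r)) (1 - p) * s%:R ^+ r <= _).
  rewrite sumr_const -cards_draws mulr_natl le_eqVlt; apply/orP; left; apply/eqP.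
  by congr (_ *+ _); apply: eq_card => A; rewrite inE.
by apply: ler_sum => A /andP[AJ /eqP Ar]; apply: cNE.
Qed.
End Transversals.

(** * Null blocks *)

Lemma ord_ltn_trans n : transitive (fun i j : 'I_n => i < j)%N.
Proof. by move=> y x z; apply: ltn_trans. Qed.

Lemma enum_ord_sorted n (A : {set 'I_n}) : sorted (fun i j : 'I_n => i < j)%N (enum A).
Proof.
have tr := @ord_ltn_trans n.
rewrite {1}/enum_mem -enumT; apply: sorted_filter => //.
have := iota_ltn_sorted 0 n; rewrite -val_enum_ord sorted_map.
by [].
Qed.

Lemma enum_set_sorted n (s : seq 'I_n) :
  sorted (fun i j : 'I_n => i < j)%N s -> enum [set k in s]%SET = s.
Proof.
have tr := @ord_ltn_trans n.
have ir : irreflexive (fun i j : 'I_n => i < j)%N by move=> x; apply: ltnn.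
move=> ss; apply: (irr_sorted_eq tr ir) => //; first exact: enum_ord_sorted.
by move=> x; rewrite mem_enum inE.
Qed.

Lemma enum_imset_sorted (U : finType) (n : nat) (le : rel U) (phi : U -> 'I_n)
    (A : {set U}) : linear_order le ->
  (forall u v, le u v -> u != v -> phi u < phi v)%N ->
  enum [set phi v | v in A]%SET = map phi (sorted_set le A).
Proof.
move=> [le_refl le_anti le_tr le_tot] phi_lt.
have mem_ss v : (v \in sorted_set le A) = (v \in A) by rewrite mem_sort mem_enum.
have -> : [set phi v | v in A]%SET = [set k in map phi (sorted_set le A)]%SET.
  apply/setP => k; rewrite inE; apply/imsetP/mapP => -[v vA ->]; exists v => //.
    by rewrite mem_ss.
  by rewrite -mem_ss.
apply: enum_set_sorted; rewrite sorted_map; apply: pairwise_sorted.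
have : pairwise le (sorted_set le A) && uniq (sorted_set le A).
  by rewrite -(sorted_pairwise le_tr) sort_sorted //= sort_uniq enum_uniq.
rewrite uniq_pairwise -pairwise_relI; apply: sub_pairwise => u v /andP[].
exact: phi_lt.
Qed.

Section Blocks.
Variables (r n : nat).
Implicit Types A : {set 'I_n.+1}.

Definition block_fst A : {set 'I_n.+1} := [set k in take r (enum A)]%SET.
Definition block_snd A : {set 'I_n.+1} := [set k in drop (r - 2) (enum A)]%SET.
Definition block_z1 A : 'I_n.+1 := nth ord0 (enum A) (r - 2).
Definition block_z2 A : 'I_n.+1 := nth ord0 (enum A) (r - 1).

End Blocks.

Lemma block_catE r n (s1 s2 : seq 'I_n.+1) (i j : 'I_n.+1) :
  size s1 = (r - 2)%N -> size s2 = (r - 2)%N -> (2 <= r)%N ->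
  sorted (fun i j : 'I_n.+1 => i < j)%N (s1 ++ [:: i, j & s2]) ->
  let B := [set k in s1 ++ [:: i, j & s2]]%SET in
  [/\ #|B| = (2 * r - 2)%N, block_fst r B = [set k in s1 ++ [:: i; j]]%SET,
      block_snd r B = [set k in [:: i, j & s2]]%SET, block_z1 r B = i & block_z2 r B = j].
Proof.
move=> z1 z2 r2 ss; rewrite /block_fst /block_snd /block_z1 /block_z2 cardE /=.
rewrite enum_set_sorted // size_cat /= z1 z2; split; first lia.
- rewrite -[[:: i, j & s2]]/([:: i; j] ++ s2) catA take_size_cat // size_cat z1 /=; lia.
- by rewrite drop_size_cat.
- by rewrite nth_cat z1 ltnn subnn.
- rewrite nth_cat z1 ifN; last lia.
  by have -> : (r - 1 - (r - 2) = 1)%N by lia.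
Qed.

Section NullCase.
Variables (R : realType) (r n : nat) (T : finType) (E : {set {set T}}).
Variables (J : {set 'I_n.+1}) (Q : {set 'I_n.+1} -> rel T).
Hypothesis r3 : (3 <= r)%N.
Implicit Types (A x y : {set 'I_n.+1}) (i j : 'I_n.+1) (t : {ffun 'I_n.+1 -> T}).

Definition bad_block A t : bool :=
  (maps_edge E (block_fst r A) t && Q A (t (block_z1 r A)) (t (block_z2 r A))) ||
  (maps_edge E (block_snd r A) t && ~~ Q A (t (block_z1 r A)) (t (block_z2 r A))).

Definition bad t : bool :=
  [exists A : {set 'I_n.+1}, [&& A \subset J, #|A| == (2 * r - 2)%N & bad_block A t]].

(* The pairs that may be tails: outside the bad tuples, no edge has its head
   here and every edge has its tail here. *)
Definition tail_pair i j : rel T := fun a b =>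
  [exists x : {set 'I_n.+1}, [&& x \subset J, #|x| == (r - 2)%N, [forall k in x, (k < i)%N] &
    [forall y : {set 'I_n.+1},
      [&& y \subset J, #|y| == (r - 2)%N & [forall k in y, (j < k)%N]] ==>
      ~~ Q [set k in enum x ++ [:: i, j & enum y]]%SET a b]]].

Let ltI := fun i j : 'I_n.+1 => (i < j)%N.

Lemma sorted_block x y i j : {in x, forall k : 'I_n.+1, (k < i)%N} -> (i < j)%N ->
  {in y, forall k : 'I_n.+1, (j < k)%N} -> sorted ltI (enum x ++ [:: i, j & enum y]).
Proof.
move=> xi ij jy; rewrite sorted_pairwise ?pairwise_cat /=; last exact: ord_ltn_trans.
have pw (z : {set 'I_n.+1}) : pairwise ltI (enum z).
  by rewrite -(sorted_pairwise (@ord_ltn_trans n.+1)); apply: enum_ord_sorted.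
have lij : ltI i j := ij; rewrite !pw lij /= andbT; apply/and3P; split.
- apply/allrelP => a b; rewrite mem_enum !inE => /xi ai /or3P[/eqP->|/eqP->|] //.
    exact: ltn_trans ij.
  by rewrite mem_enum => /jy jb; apply: ltn_trans jb; apply: ltn_trans ij.
- by apply/allP => b; rewrite mem_enum => /jy jb; apply: ltn_trans jb.
- by apply/allP => b; rewrite mem_enum => /jy.
Qed.

Lemma block_sub x y i j : x \subset J -> y \subset J -> i \in J -> j \in J ->
  [set k in enum x ++ [:: i, j & enum y]]%SET \subset J.
Proof.
move=> /fintype.subsetP xJ /fintype.subsetP yJ iJ jJ; apply/fintype.subsetP => k.
rewrite inE mem_cat !inE !mem_enum => /or4P[/xJ|/eqP->|/eqP->|/yJ] //.
Qed.

(** In both halves [A] is completed to a block. If its head were a tail pair with witness [x], then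
    [x] followed by [A] would be a block with second edge [A] and middle pair outside [Q], hence
    bad. For its tail the witness is the set of the first [r - 2] parts of [A]: with any [y], the
    first edge of the block is [A], so the middle pair is outside [Q]. *)
Lemma not_bad_edge t A : ~~ bad t -> A \subset J -> #|A| = r -> maps_edge E A t ->
  let a k := nth ord0 (enum A) k in
  ~~ tail_pair (a 0%N) (a 1%N) (t (a 0%N)) (t (a 1%N)) /\
  tail_pair (a (r - 2)%N) (a (r - 1)%N) (t (a (r - 2)%N)) (t (a (r - 1)%N)).
Proof.
move=> nb AJ Ar EA a.
have nbB (B : {set 'I_n.+1}) : B \subset J -> #|B| = (2 * r - 2)%N -> ~~ bad_block B t.
  move=> BJ cB; apply: contraNN nb => bB; apply/existsP; exists B.
  by rewrite BJ cB eqxx.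
have sA : size (enum A) = r by rewrite -cardE.
have aA k : (k < r)%N -> a k \in A by move=> kr; rewrite -mem_enum mem_nth // sA.
have aJ k : (k < r)%N -> a k \in J by move=> /aA; apply: (fintype.subsetP AJ).
have lta k l : (k < l)%N -> (l < r)%N -> (a k < a l)%N.
  move=> kl lr; apply: (sorted_ltn_nth (@ord_ltn_trans n.+1) ord0 (enum_ord_sorted A)) => //.
    by rewrite inE sA; apply: ltn_trans lr.
  by rewrite inE sA.
split.
  apply/existsP => -[x /and4P[xJ /eqP cx /forall_inP xi /forallP Hx]].
  pose y : {set 'I_n.+1} := [set k in drop 2 (enum A)]%SET.
  have ey : enum y = drop 2 (enum A).
    by apply: enum_set_sorted; apply: drop_sorted; apply: enum_ord_sorted.
  have eA : enum A = [:: a 0%N, a 1%N & drop 2 (enum A)].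
    by rewrite -!drop_nth ?sA ?drop0 //; lia.
  have yJ : y \subset J.
    apply/fintype.subsetP => k; rewrite inE => /mem_drop; rewrite mem_enum.
    exact: (fintype.subsetP AJ).
  have cy : #|y| = (r - 2)%N by rewrite cardE ey size_drop sA.
  have jy : {in y, forall k : 'I_n.+1, (a 1%N < k)%N}.
    move=> k; rewrite inE => /(nthP ord0)[l]; rewrite size_drop sA => lr <-.
    by rewrite nth_drop; apply: lta; lia.
  have := Hx y; rewrite yJ cy eqxx /=; have -> : [forall k in y, (a 1%N < k)%N] by apply/forall_inP.
  move=> /= nQ.
  have ss : sorted ltI (enum x ++ [:: a 0%N, a 1%N & enum y]).
    by apply: sorted_block => //; apply: lta; lia.
  have [|||cB _ fB z1B z2B] := @block_catE r n _ _ _ _ _ _ _ ss; rewrite -?cardE //; first lia.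
  have /negP[] := nbB _ (block_sub xJ yJ (aJ 0%N ltac:(lia)) (aJ 1%N ltac:(lia))) cB.
  rewrite /bad_block fB z1B z2B nQ ey -eA.
  have -> : [set k in enum A]%SET = A by apply/setP => k; rewrite inE mem_enum.
  by rewrite EA orbT.
pose x : {set 'I_n.+1} := [set k in take (r - 2) (enum A)]%SET.
have ex : enum x = take (r - 2) (enum A).
  by apply: enum_set_sorted; apply: take_sorted; apply: enum_ord_sorted.
have eA : enum A = take (r - 2) (enum A) ++ [:: a (r - 2)%N; a (r - 1)%N].
  rewrite -[LHS](cat_take_drop (r - 2)) (drop_nth ord0) ?sA; last lia.
  have -> : (r - 1 = (r - 2).+1)%N by lia.
  rewrite (drop_nth ord0) ?sA; last lia.
  by rewrite drop_oversize ?sA //; lia.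
have xJ : x \subset J.
  apply/fintype.subsetP => k; rewrite inE => /mem_take; rewrite mem_enum.
  exact: (fintype.subsetP AJ).
have cx : #|x| = (r - 2)%N by rewrite cardE ex size_takel // sA; lia.
have xi : {in x, forall k : 'I_n.+1, (k < a (r - 2)%N)%N}.
  move=> k; rewrite inE => /(nthP ord0)[l]; rewrite size_takel ?sA; last lia.
  by move=> lr <-; rewrite nth_take //; apply: lta => //; lia.
apply/existsP; exists x; rewrite xJ cx eqxx /=; apply/andP; split; first exact/forall_inP.
apply/forallP => y; apply/implyP => /and3P[yJ /eqP cy /forall_inP jy].
have ss : sorted ltI (enum x ++ [:: a (r - 2)%N, a (r - 1)%N & enum y]).
  by apply: sorted_block => //; apply: lta; lia.
have [|||cB eB _ z1B z2B] := @block_catE r n _ _ _ _ _ _ _ ss; rewrite -?cardE //; first lia.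
have := nbB _ (block_sub xJ yJ (aJ (r - 2)%N ltac:(lia)) (aJ (r - 1)%N ltac:(lia))) cB.
rewrite /bad_block eB z1B z2B negb_or => /andP[+ _].
rewrite ex -eA.
have -> : [set k in enum A]%SET = A by apply/setP => k; rewrite inE mem_enum.
by rewrite EA.
Qed.

End NullCase.

(** * Edge density when all blocks are null *)

Lemma cnt_exists (R : realType) (I T K : finType) (V : I -> {set T})
    (P : K -> {ffun I -> T} -> bool) :
  count_in R V (fun t => [exists k, P k t]) <= \sum_k count_in R V (P k).
Proof.
rewrite cntE; under [leRHS]eq_bigr do rewrite cntE.
rewrite exchange_big /=; apply: ler_sum => t _; case: existsP => [[k Pk]|_]; last exact: sumr_ge0.
by rewrite (bigD1 k) //= Pk lerDl sumr_ge0.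
Qed.

Section NullDensity.
Variables (R : realType) (r n q : nat) (T : finType) (E : {set {set T}}).
Variables (Q : {set 'I_n.+1} -> rel T).
Hypothesis r3 : (3 <= r)%N.
Hypothesis q0 : (0 < q)%N.
Implicit Types (A J : {set 'I_n.+1}) (V : 'I_n.+1 -> {set T}).

Local Notation cnt := (count_in R).
Local Notation vol := (volume R).

Definition null_block (c : R) A V : Prop :=
  null_pair (maps_edge E (block_fst r A)) (maps_edge E (block_snd r A))
    (block_z1 r A) (block_z2 r A) (Q A) c V.

(** Union bound over at most [2 ^ n.+1] blocks, with two failures of density [c] for each. *)
Lemma cnt_bad (c : R) J V : 0 <= c ->
  (forall A, A \subset J -> #|A| = (2 * r - 2)%N -> null_block c A V) ->
  cnt V (bad r E J Q) <= 2 ^+ n.+2 * c * vol V.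
Proof.
move=> c0 HJ; apply: le_trans (cnt_exists _ _ _) _.
apply: le_trans (_ : \sum_(A : {set 'I_n.+1}) 2 * c * vol V <= _).
  apply: ler_sum => A _.
  have [/andP[AJ /eqP Ar]|nA] := boolP ((A \subset J) && (#|A| == (2 * r - 2)%N)).
    have [H1 H2] := HJ A AJ Ar; rewrite -mulrA mulr2n [leRHS]mulrDl mul1r.
    apply: le_trans (lerD H1 H2); apply: le_trans (cntU _ _ _ _).
    by apply: le_cnt => t tV /and3P[].
  apply: le_trans (_ : cnt V xpred0 <= _).
    by apply: le_cnt => t tV /and3P[AJ Ar]; rewrite AJ Ar in nA.
  by rewrite cntE big1 // !mulr_ge0 ?vol_ge0.
rewrite sumr_const -cardsT -powersetT card_powerset cardsT card_ord.
by rewrite -[leLHS]mulr_natr natrX le_eqVlt [2 ^+ n.+2]exprS; apply/orP; left; apply/eqP; ring.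
Qed.

(** This is x(1 - x) <= 1/4 at x = b/q, with an error of one bucket width. *)
Lemma bucket_density (b : nat) : (b <= q)%N ->
  (1 - b%:R / q%:R) * (b.+1%:R / q%:R) <= 1 / 4 + 1 / q%:R :> R.
Proof.
move=> bq; have Q0 : 0 < q%:R :> R by rewrite ltr0n.
rewrite -(natr1 b) [(_ + 1) / _]mulrDl; set x := b%:R / q%:R; set y := 1 / q%:R.
have x1 : x <= 1 by rewrite /x ler_pdivrMr // mul1r ler_nat.
have x0 : 0 <= x by rewrite divr_ge0.
have y0 : 0 <= y by rewrite divr_ge0.
have xy0 := mulr_ge0 x0 y0; have := sqr_ge0 (x - 1 / 2); rewrite expr2.
move: x1 x0 y0 xy0; move: x y => x y; nra.
Qed.

(** The tail event [W] has density at most (b + 1)/q. Conditionally on all coordinates but [a 0],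
    the head avoids the tail pairs with probability at most 1 - b/q. The vertex [a 0] is never in
    the tail, even for r = 3, where [a 1] belongs to both head and tail. *)
Lemma cnt_edge_le J V (s b : nat) A :
  (b <= q)%N -> (0 < s)%N -> (forall i, #|V i| = s) ->
  A \subset J -> #|A| = r ->
  (forall i j, i \in A -> j \in A -> (i < j)%N -> forall x, x \in V j ->
     b * s <= q * #|[set a in V i | tail_pair r J Q i j a x]%SET| < b.+1 * s)%N ->
  cnt V (maps_edge E A) <= cnt V (bad r E J Q) + (1 / 4 + 1 / q%:R) * vol V.
Proof.
move=> bq s0 Vs AJ Ar Hb.
pose a k := nth ord0 (enum A) k.
have sA : size (enum A) = r by rewrite -cardE.
have aA k : (k < r)%N -> a k \in A by move=> kr; rewrite -mem_enum mem_nth // sA.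
have lta k l : (k < l)%N -> (l < r)%N -> (a k < a l)%N.
  move=> kl lr; apply: (sorted_ltn_nth (@ord_ltn_trans n.+1) ord0 (enum_ord_sorted A)) => //.
    by rewrite inE sA; apply: ltn_trans lr.
  by rewrite inE sA.
have r0 : (0 < r)%N by lia.
have r1 : (1 < r)%N by lia.
have r2' : (r - 2 < r)%N by lia.
have r1' : (r - 1 < r)%N by lia.
have r21' : (r - 2 < r - 1)%N by lia.
have Q0 : 0 < q%:R :> R by rewrite ltr0n.
have V0 : 0 < vol V by apply: vol_gt0 => i; rewrite -card_gt0 Vs.
pose tp (k l : nat) := tail_pair r J Q (a k) (a l).
pose W (t : {ffun 'I_n.+1 -> T}) := tp (r - 2)%N (r - 1)%N (t (a (r - 2)%N)) (t (a (r - 1)%N)).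
have aN k l : (k < l)%N -> (l < r)%N -> a k != a l.
  by move=> kl lr; apply/eqP => e; have := lta k l kl lr; rewrite e ltnn.
have H1 : cnt V (fun t => W t && ~~ tp 0%N 1%N (t (a 0%N)) (t (a 1%N)))
   <= (1 - b%:R / q%:R) * cnt V W.
  apply: (@cnt_coord_le R _ _ V (a 0%N) (a 1%N) W (fun x y => ~~ tp 0%N 1%N x y)) => //.
  - by apply: aN; lia.
  - move=> t u tu; rewrite /W !tu // !inE eq_sym; apply: aN; lia.
  - move=> x xV.
    have /andP[Hx _] := Hb (a 0%N) (a 1%N) (aA 0%N r0) (aA 1%N r1) (lta 0%N 1%N isT r1) x xV.
    have : (#|[set z in V (a 0%N) | tp 0%N 1%N z x]%SET| +
       #|[set z in V (a 0%N) | ~~ tp 0%N 1%N z x]%SET| = s)%N.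
      rewrite -(Vs (a 0%N)) -(cardsID [set z | tp 0%N 1%N z x]%SET (V (a 0%N))).
      by congr (_ + _)%N; apply: eq_card => z; rewrite !inE // andbC.
    move=> Es; rewrite -/(tp 0%N 1%N) in Hx.
    have Hq : b%:R / q%:R * s%:R <= #|[set z in V (a 0%N) | tp 0%N 1%N z x]%SET|%:R :> R.
      by rewrite mulrAC ler_pdivrMr // -!natrM ler_nat [leqRHS]mulnC.
    rewrite Vs mulrBl mul1r lerBrDr; apply: le_trans (lerD (lexx _) Hq) _.
    by rewrite -natrD addnC Es.
have H2 : cnt V W <= b.+1%:R / q%:R * vol V.
  apply: (@cnt_coord_le R _ _ V (a (r - 2)%N) (a (r - 1)%N) xpredT
    (tp (r - 2)%N (r - 1)%N)) => //.
  - by apply: aN; lia.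
  - move=> x xV.
    have /andP[_ Hx] := Hb (a (r - 2)%N) (a (r - 1)%N) (aA _ r2') (aA _ r1')
      (lta _ _ r21' r1') x xV.
    rewrite Vs mulrAC ler_pdivlMr // -!natrM ler_nat ltnW // mulnC.
    exact: Hx.
apply: le_trans (_ : cnt V (bad r E J Q) +
   cnt V (fun t => W t && ~~ tp 0%N 1%N (t (a 0%N)) (t (a 1%N))) <= _).
  apply: le_trans (cntU _ _ _ _); apply: le_cnt => t tV EA; split => //.
  have [//|nb] := boolP (bad r E J Q t).
  have [h1 h2] := not_bad_edge r3 nb AJ Ar EA; exact/andP.
rewrite lerD2l; apply: le_trans H1 _.
apply: le_trans (ler_wpM2l _ H2) _.
  by rewrite subr_ge0 ler_pdivrMr // mul1r ler_nat.
by rewrite mulrA ler_wpM2r ?vol_ge0 // bucket_density.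
Qed.

End NullDensity.

(** Equalizing keeps the density of bad tuples; the bucketing that follows divides each of the
    [n.+1] parts by [q.+1 ^ n.+1], and the density of bad tuples may grow by the product of these
    factors. Ramsey applied to pairs of parts makes the bucket constant. The bound [M] depends on
    [q] and [m] only, so [c] may be chosen after [n]. *)
Lemma null_case (R : realType) (r q m : nat) : (3 <= r)%N -> (0 < q)%N ->
  exists M : nat, forall (n s : nat) (T : finType) (E : {set {set T}})
    (Q : {set 'I_n.+1} -> rel T) (c : R) (J : {set 'I_n.+1}) (V : 'I_n.+1 -> {set T}),
    0 <= c -> (0 < s)%N -> (M <= #|J|)%N ->
    (forall i j x, x \in V i -> x \in V j -> i = j) ->
    (forall i, s * q.+1 ^ n.+1 <= #|V i|)%N ->
    (forall A : {set 'I_n.+1}, A \subset J -> #|A| = (2 * r - 2)%N -> null_block r E Q c A V) ->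
    exists S : {set T}, #|S| = (m * s)%N /\
      #|[set e in E | (#|e| == r) && (e \subset S)]%SET|%:R
      + (1 - (1 / 4 + 1 / q%:R + 2 ^+ n.+2 * c * (q.+1 ^ n.+1)%:R ^+ n.+1))
        * 'C(m, r)%:R * s%:R ^+ r
      <= 'C(m * s, r)%:R :> R.
Proof.
move=> r3 q0; have [M HM] := ramsey 2 q m.
exists M => n s T E Q c J V c0 s0 MJ disjV sV HJ.
have K0 : (0 < q.+1 ^ n.+1)%N by rewrite expn_gt0.
have sK0 : (0 < s * q.+1 ^ n.+1)%N by rewrite muln_gt0 s0.
have [X1 [X1V X1s bX1]] := equalize R (bad r E J Q) sK0 sV.
have [X [XX1 Xs HX]] := bucket (tail_pair r J Q) s0 X1s.
have disjX i j x : x \in X i -> x \in X j -> i = j.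
  by move=> /(fintype.subsetP (XX1 i)) /(fintype.subsetP (X1V i)) xi
    /(fintype.subsetP (XX1 j)) /(fintype.subsetP (X1V j)); apply: disjV.
pose ok i j (b : 'I_q.+1) := [forall x in X j,
  (b * s <= q * #|[set a in X i | tail_pair r J Q i j a x]%SET| < b.+1 * s)%N].
(* The default [ord0] is never reached when [i < j]. *)
pose bb i j := if [pick b | ok i j b] is Some b then b else ord0.
have bbP (i j : 'I_n.+1) : (i < j)%N -> ok i j (bb i j).
  move=> ij; rewrite /bb; case: pickP => // nb.
  by have [b Hb] := HX i j ij; have /forall_inP[] := nb b.
pose col (A : {set 'I_n.+1}) := bb (nth ord0 (enum A) 0) (nth ord0 (enum A) 1).
have [J2 [J2J cJ2 [b Hb]]] := HM _ J col MJ.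
exists [set x | [exists i in J2, x \in X i]]%SET; split.
  by rewrite (card_union_parts disjX Xs) cJ2.
set p := 1 / 4 + _ + _.
rewrite -cJ2; apply: (@edges_le_transversals R _ _ X s disjX Xs s0 E J2 r p) => A AJ2 Ar.
have AJ : A \subset J by apply: fintype.subset_trans J2J.
have Hbb (i j : 'I_n.+1) : i \in A -> j \in A -> (i < j)%N -> bb i j = b.
  move=> iA jA ij; rewrite -(Hb [set i; j]%SET).
  - rewrite /col; suff -> : enum [set i; j]%SET = [:: i; j] by [].
    have -> : [set i; j]%SET = [set k in [:: i; j]]%SET.
      by apply/setP => k; rewrite !inE.
    by apply: enum_set_sorted; rewrite /= ij.
  - by rewrite finset.subUset !finset.sub1set !(fintype.subsetP AJ2).
  - by rewrite cards2; case: eqP ij => // ->; rewrite ltnn.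
have bq : (b <= q)%N by rewrite -ltnS.
have Hdeg (i j : 'I_n.+1) : i \in A -> j \in A -> (i < j)%N -> forall x, x \in X j ->
    (b * s <= q * #|[set a in X i | tail_pair r J Q i j a x]%SET| < b.+1 * s)%N.
  move=> iA jA ij x xX; rewrite -(Hbb i j iA jA ij).
  exact: (forall_inP (bbP i j ij)).
have := @cnt_edge_le R r n q T E Q r3 q0 J X s b A bq s0 Xs AJ Ar Hdeg.
move=> H; apply: (le_trans H).
rewrite addrC /p [leRHS]mulrDl lerD2l.
have V0 : 0 < volume R V.
  by apply: vol_gt0 => i; rewrite -card_gt0; apply: leq_trans (sV i).
have b1 : count_in R X1 (bad r E J Q) <= 2 ^+ n.+2 * c * volume R X1.
  rewrite -(ler_pM2r V0); apply: le_trans bX1 _; rewrite mulrAC ler_wpM2r ?vol_ge0 //.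
  exact: cnt_bad.
apply: le_trans (le_cnt_sub R XX1 (fun t _ bt => bt)) _; apply: le_trans b1 _.
have -> : volume R X1 = (q.+1 ^ n.+1)%:R ^+ n.+1 * volume R X.
  have dX1 i j x : x \in X1 i -> x \in X1 j -> i = j.
    by move=> /(fintype.subsetP (X1V i)) xi /(fintype.subsetP (X1V j)); apply: disjV.
  by rewrite (vol_uniform R X1s) (vol_uniform R Xs) card_ord natrM exprMn mulrC.
by rewrite mulrA.
Qed.

(** * Copies of F from good blocks *)

Lemma block_inter r n (A : {set 'I_n.+1}) : (2 <= r)%N -> #|A| = (2 * r - 2)%N ->
  [/\ block_z1 r A \in block_fst r A :&: block_snd r A,
      block_z2 r A \in block_fst r A :&: block_snd r A &
      block_fst r A :&: block_snd r A \subset [set block_z1 r A; block_z2 r A]%SET].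
Proof.
move=> r2 cA; have sA : size (enum A) = (2 * r - 2)%N by rewrite -cardE.
have eA : enum A = take (r - 2) (enum A) ++ [:: block_z1 r A, block_z2 r A & drop r (enum A)].
  rewrite -[LHS](cat_take_drop (r - 2)) (drop_nth ord0) ?sA; last lia.
  rewrite (_ : (r - 2).+1 = (r - 1)%N); last lia.
  rewrite (drop_nth ord0) ?sA; last lia.
  by rewrite (_ : (r - 1).+1 = r); last lia.
have s1 : size (take (r - 2) (enum A)) = (r - 2)%N by rewrite size_takel // sA; lia.
have := enum_uniq A; rewrite /block_fst /block_snd; move: eA s1.
move: (take _ _) (drop r _) (block_z1 _ _) (block_z2 _ _) => s s' i j -> ss.
rewrite drop_size_cat //.
rewrite (_ : take r (s ++ [:: i, j & s']) = s ++ [:: i; j]); last first.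
  rewrite -[[:: i, j & s']]/([:: i; j] ++ s') catA take_size_cat // size_cat ss /=; lia.
rewrite cat_uniq => /and3P[_ /hasPn nss /and3P[nis njs _]].
split.
- by rewrite !inE mem_cat !inE !eqxx !orbT.
- by rewrite !inE mem_cat !inE !eqxx !orbT.
apply/fintype.subsetP => k; rewrite !inE mem_cat !inE => /andP[+ ks'].
by case/orP => // ks; have := nss k; rewrite !inE ks' ks => /(_ isT).
Qed.

Section GoodCase.
Variables (r n : nat) (F : r_graph r) (le : rel (vertex F)) (J : {set 'I_n.+1}).
Hypothesis le_lin : linear_order le.
Hypothesis cardJ : (#|vertex F| <= #|J|)%N.

Definition part_of (v : vertex F) : 'I_n.+1 :=
  nth ord0 (enum J) (index v (sorted_set le [set: vertex F]%SET)).

Let W := sorted_set le [set: vertex F]%SET.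

Lemma mem_sorted_set (A : {set vertex F}) v : (v \in sorted_set le A) = (v \in A).
Proof. by rewrite mem_sort mem_enum. Qed.

Lemma size_sorted_set (A : {set vertex F}) : size (sorted_set le A) = #|A|.
Proof. by rewrite size_sort -cardE. Qed.

Lemma sorted_sorted_set (A : {set vertex F}) : sorted le (sorted_set le A).
Proof. by apply: sort_sorted; case: le_lin. Qed.

Lemma index_lt v : (index v W < #|J|)%N.
Proof.
apply: leq_trans cardJ; rewrite -[ltnRHS]cardsT -size_sorted_set index_mem.
by rewrite mem_sorted_set inE.
Qed.

Lemma part_of_J v : part_of v \in J.
Proof. by rewrite -mem_enum mem_nth // -cardE index_lt. Qed.

Lemma part_of_lt u v : le u v -> u != v -> (part_of u < part_of v)%N.
Proof.
case: (le_lin) => le_refl le_anti le_tr le_tot uv nuv.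
have iuv : (index u W < index v W)%N.
  rewrite ltnNge; apply: contra nuv => ivu; apply/eqP/le_anti; rewrite uv /=.
  apply: (sorted_leq_index le_tr le_refl (sorted_sorted_set [set: vertex F]%SET)) ivu.
    by rewrite mem_sorted_set inE.
  by rewrite mem_sorted_set inE.
have := sorted_ltn_nth (@ord_ltn_trans n.+1) ord0 (enum_ord_sorted J).
by apply; rewrite ?inE -?cardE ?index_lt.
Qed.

Lemma part_of_inj : injective part_of.
Proof.
case: (le_lin) => _ _ _ le_tot u v uv; apply/eqP; apply: contraT => nuv.
have /orP[h|h] := le_tot u v; have := part_of_lt h; rewrite uv ltnn.
  by move=> /(_ nuv).
by rewrite eq_sym => /(_ nuv).
Qed.

Lemma enum_part_of (A : {set vertex F}) :
  enum [set part_of v | v in A]%SET = map part_of (sorted_set le A).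
Proof. exact: enum_imset_sorted le_lin part_of_lt. Qed.

Lemma twins_sym (e f : {set vertex F}) : twins e f -> twins f e.
Proof. by case=> eF fF fe c2; split; rewrite 1?eq_sym // finset.setIC. Qed.

(** As the unions differ and twins are unique, [a'] is neither [a] nor its twin [b]. *)
Lemma twins_far (a b a' b' : {set vertex F}) : quasi_linear F ->
  twins a b -> twins a' b' -> a :|: b != a' :|: b' -> (#|a :&: a'| <= 1)%N.
Proof.
move=> qF ab ab' nab; have [aF bF _ _] := ab; have [aF' _ _ _] := ab'.
have uniq_twin (x y z : {set vertex F}) : twins x y -> twins x z -> y = z.
  move=> xy xz; have [xF _ _ _] := xy.
  by have [g [[_ ug] _]] := qF x xF; rewrite -(ug y xy) -(ug z xz).
have [g [[ag ug] far]] := qF a aF; apply: far => //.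
rewrite (ug b ab) !inE negb_or; apply/andP; split; apply: contraNneq nab => aa.
  by rewrite aa in ab' *; rewrite (uniq_twin _ _ _ ab ab').
by rewrite aa in ab' *; rewrite (uniq_twin _ _ _ ab' (twins_sym ab)) finset.setUC.
Qed.

(** This is where the shape of the descriptive sequence enters: the letters X and Z fill the first
    [r] positions, the letters Z and Y the last [r], exactly as the two edges of a block do. *)
Lemma describes_block (a b : {set vertex F}) : (2 <= r)%N -> twins a b ->
  xzy_seq r = map (letter_of a b) (sorted_set le (a :|: b)) ->
  let A := [set part_of v | v in a :|: b]%SET in
  [/\ #|A| = (2 * r - 2)%N, block_fst r A = [set part_of v | v in a]%SET &
      block_snd r A = [set part_of v | v in b]%SET].
Proof.
move=> r2 ab; set w := sorted_set _ _ => Hw A.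
have eA : enum A = map part_of w by exact: enum_part_of.
have sw : size w = (2 * r - 2)%N.
  rewrite -(size_map (letter_of a b)) -Hw !size_cat !size_nseq; lia.
have wE v : (v \in w) = (v \in a) || (v \in b) by rewrite mem_sorted_set inE.
have im (s : seq (vertex F)) (B : {set vertex F}) : s =i B ->
    [set k in map part_of s]%SET = [set part_of v | v in B]%SET.
  move=> sB; apply/setP => k; rewrite inE; apply/mapP/imsetP => -[v vs ->]; exists v => //.
    by rewrite -sB.
  by rewrite sB.
have all_letter (s : seq (vertex F)) k (l : letter) : map (letter_of a b) s = nseq k l ->
    {in s, forall v, letter_of a b v = l}.
  by move=> Hs v vs; have := map_f (letter_of a b) vs; rewrite Hs mem_nseq => /andP[_ /eqP].
pose w1 := take (r - 2) w; pose w2 := take 2 (drop (r - 2) w); pose w3 := drop r w.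
have Ew : w = w1 ++ w2 ++ w3.
  rewrite -{1}(cat_take_drop (r - 2) w) -{1}(cat_take_drop 2 (drop (r - 2) w)) drop_drop.
  by rewrite (_ : (2 + (r - 2) = r)%N) //; lia.
have E1 : map (letter_of a b) w1 = nseq (r - 2) LX.
  by rewrite map_take -Hw take_size_cat // size_nseq.
have E2 : map (letter_of a b) w2 = nseq 2 LZ.
  by rewrite map_take map_drop -Hw drop_size_cat ?size_nseq // take_size_cat.
have E3 : map (letter_of a b) w3 = nseq (r - 2) LY.
  rewrite map_drop -Hw /xzy_seq catA drop_size_cat // size_cat !size_nseq; lia.
have wsub v : v \in w1 \/ v \in w2 \/ v \in w3 <-> v \in w.
  rewrite Ew !mem_cat; split; first by case=> [->|[->|->]]; rewrite ?orbT.
  by case/or3P; [left|right; left|right; right].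
have in1 v : v \in w1 -> v \in a /\ v \notin b.
  by move=> /(all_letter _ _ _ E1); rewrite /letter_of; case: (v \in a) => //; case: (v \in b).
have in2 v : v \in w2 -> v \in a /\ v \in b.
  by move=> /(all_letter _ _ _ E2); rewrite /letter_of; case: (v \in a) => //; case: (v \in b).
have in3 v : v \in w3 -> v \notin a /\ v \in b.
  move=> vw3; have := all_letter _ _ _ E3 v vw3; rewrite /letter_of.
  have : v \in w by apply/wsub; right; right.
  by rewrite wE; case: (v \in a) => //=; case: (v \in b).
have inw v : v \in w -> v \in w1 \/ v \in w2 \/ v \in w3 by move=> /wsub.
split; first by rewrite cardE eA size_map.
- rewrite /block_fst eA -map_take; apply: im => v.
  have -> : take r w = w1 ++ w2.
    by rewrite {1}Ew catA take_size_cat // size_cat !size_takel ?size_drop ?sw; lia.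
  rewrite mem_cat; apply/orP/idP; first by case=> [/in1[]|/in2[]].
  move=> va; have /inw[->|[->|/in3[]]] : v \in w by rewrite wE va.
  - by left.
  - by right.
  - by rewrite va.
- rewrite /block_snd eA -map_drop; apply: im => v.
  have -> : drop (r - 2) w = w2 ++ w3.
    by rewrite {1}Ew drop_size_cat // size_takel // sw; lia.
  rewrite mem_cat; apply/orP/idP; first by case=> [/in2[]|/in3[]].
  move=> vb; have /inw[/in1[]|[->|->]] : v \in w by rewrite wE vb orbT.
  - by rewrite vb.
  - by left.
  - by right.
Qed.

Lemma good_case (R : realType) (H : r_graph r) (V : 'I_n.+1 -> {set vertex H})
    (Q : {set 'I_n.+1} -> rel (vertex H)) (good : pred {set 'I_n.+1})
    (ks : seq {set 'I_n.+1}) (c : R) :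
  (2 <= r)%N -> quasi_linear F ->
  (forall e f : {set vertex F}, twins e f -> describes le (xzy_seq r) e f) ->
  0 < volume R V -> 0 < c -> c <= 1 -> uniq ks ->
  (forall i j x, x \in V i -> x \in V j -> i = j) ->
  (forall A : {set 'I_n.+1}, A \subset J -> #|A| = (2 * r - 2)%N -> (A \in ks) && good A) ->
  chain (fun A => maps_edge (edges H) (block_fst r A))
    (fun A => maps_edge (edges H) (block_snd r A))
    (@block_z1 r n) (@block_z2 r n) Q good 1 c ks V ->
  contains H F.
Proof.
move=> r2 qF desc V0 c0 c1 uks disjV HJ ch.
pose selP (A : {set 'I_n.+1}) := exists a b : {set vertex F}, [/\ twins a b,
  A = [set part_of v | v in a :|: b]%SET, #|A| = (2 * r - 2)%N,
  block_fst r A = [set part_of v | v in a]%SET & block_snd r A = [set part_of v | v in b]%SET].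
pose sel A := `[< selP A >].
(* A description may hold with the two edges exchanged; [a] and [b] are the twins in the order of
   the block. *)
have blockP (e f : {set vertex F}) : twins e f ->
    exists a b : {set vertex F}, [/\ twins a b, a :|: b = e :|: f,
      selP [set part_of v | v in a :|: b]%SET,
      block_fst r [set part_of v | v in a :|: b]%SET = [set part_of v | v in a]%SET &
      block_snd r [set part_of v | v in a :|: b]%SET = [set part_of v | v in b]%SET /\
      (e = a \/ e = b)].
  move=> ef; case: (desc e f ef) => Hw.
    have [h1 h2 h3] := describes_block r2 ef Hw.
    by exists e, f; split => //; [exists e, f|split => //; left].
  rewrite finset.setUC in Hw.
  have [h1 h2 h3] := describes_block r2 (twins_sym ef) Hw.
  exists f, e; split => //; [exact: twins_sym|exact: finset.setUC| |split => //; right] => //.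
  by exists f, e; split => //; apply: twins_sym.
have selJ A : sel A -> (A \in ks) && good A.
  move=> /asboolP[a [b [_ -> cA _ _]]]; apply: HJ => //.
  by apply/fintype.subsetP => k /imsetP[v _ ->]; apply: part_of_J.
have [|||||t [tV _ tks]] := @embed_chain R _ _ (edges H) _ _ _ _ _ Q good sel ks c [::] V
    V0 c0 uks _ _ _ _ ch.
- by move=> A _ /selJ /andP[].
- by move=> A _ /asboolP[a [b [_ _ cA _ _]]]; apply: block_inter.
- by move=> g A.
- move=> A A' _ _ /asboolP[a [b [ab EA _ fA sA]]] /asboolP[a' [b' [ab' EA' _ fA' sA']]] AA' g.
  have nab : a :|: b != a' :|: b'.
    by apply: contraNneq AA' => nab; rewrite EA EA' nab.
  have nba : b :|: a != a' :|: b' by rewrite finset.setUC.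
  have nab' : a :|: b != b' :|: a' by rewrite [X in _ != X]finset.setUC.
  have nba' : b :|: a != b' :|: a' by rewrite finset.setUC.
  have far := twins_far qF; have ba := twins_sym ab; have ba' := twins_sym ab'.
  have cI (x y : {set vertex F}) :
      #|[set part_of v | v in x] :&: [set part_of v | v in y]| = #|x :&: y|.
    by rewrite -imsetI ?card_imset //; [exact: part_of_inj|move=> ? ? _ _; apply: part_of_inj].
  by rewrite fA sA fA' sA' !inE => /orP[] /eqP ->; rewrite !cI;
    split; [apply: far ab ab' nab|apply: far ab ba' nab'|
      apply: far ba ab' nba|apply: far ba ba' nba'].
- by rewrite ler_piMl ?vol_ge0.
exists (fun v => t (part_of v)); split.
  move=> u v tuv; apply: part_of_inj; move/in_box: tV => tV.
  by apply: (disjV _ _ _ (tV (part_of u))); rewrite tuv.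
move=> e eF; have [f [[ef _] _]] := qF e eF.
have [a [b [ab _ sP fA [sA eab]]]] := blockP e f ef.
have sel1 : sel [set part_of v | v in a :|: b]%SET by apply/asboolP.
have /andP[inks _] := selJ _ sel1.
have [] := tks _ inks sel1; rewrite /maps_edge fA sA -!imset_comp => h1 h2.
by case: eab => ->.
Qed.

End GoodCase.

(** * The upper bound *)

Lemma ffact_blowup m s r : (m ^_ r * s ^ r <= (m * s) ^_ r)%N.
Proof.
elim: r => [|r IH]; first by rewrite !ffactn0 expn0.
rewrite !ffactnSr expnSr mulnACA leq_mul // mulnBl.
have [->|s0] := posnP s; first by rewrite !muln0.
by rewrite leq_sub2l // leq_pmulr.
Qed.

Lemma ffact_ge (R : realType) (m k r : nat) : (k <= r)%N -> (r <= m)%N -> (0 < m)%N ->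
  m%:R ^+ k * (1 - k%:R * r%:R / m%:R) <= (m ^_ k)%:R :> R.
Proof.
move=> kr rm m0; have M0 : 0 < m%:R :> R by rewrite ltr0n.
elim: k kr => [|k IH] kr; first by rewrite expr0 mul0r mul0r subr0 mulr1 ffactn0.
rewrite ffactnSr natrM natrB; last by lia.
have := IH (ltnW kr); set x := m%:R in M0 *; set a := (m ^_ k)%:R => H.
have kx : k%:R <= x by rewrite ler_nat; lia.
have kr' : k%:R <= r%:R :> R by rewrite ler_nat; lia.
have r0 : 0 <= r%:R :> R by [].
have k0 : 0 <= k%:R :> R by [].
apply: le_trans (ler_wpM2r (_ : 0 <= x - k%:R) H); last by rewrite subr_ge0.
rewrite exprSr -!mulrA ler_wpM2l ?exprn_ge0 ?(ltW M0) //.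
rewrite -natr1; move: (k%:R) (r%:R) kx kr' r0 k0 => kk rr kx kr' r0 k0.
rewrite -(ler_pM2r M0).
have -> : x * (1 - (kk + 1) * (rr / x)) * x = x * (x - (kk + 1) * rr) by field; rewrite gt_eqF.
have -> : (1 - kk * (rr / x)) * (x - kk) * x = (x - kk * rr) * (x - kk) by field; rewrite gt_eqF.
nra.
Qed.

(** Almost all [r]-subsets of [m] equal parts are transversal once [m] is large compared with r^2,
    so that an edge bound on transversals decides the density. *)
Lemma bin_blowup (R : realType) m s r : (r <= m)%N -> (0 < m)%N ->
  (1 - r%:R * r%:R / m%:R) * 'C(m * s, r)%:R <= 'C(m, r)%:R * s%:R ^+ r :> R /\
  'C(m, r)%:R * s%:R ^+ r <= 'C(m * s, r)%:R :> R.
Proof.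
move=> rm m0; have f0 : 0 < (r`!)%:R :> R by rewrite ltr0n fact_gt0.
have M0 : 0 < m%:R :> R by rewrite ltr0n.
split; last first.
  rewrite -natrX -natrM ler_nat -(leq_pmul2r (fact_gt0 r)) mulnAC !bin_ffact.
  exact: ffact_blowup.
have ff k : 'C(k, r)%:R * (r`!)%:R = (k ^_ r)%:R :> R by rewrite -natrM bin_ffact.
rewrite -(ler_pM2r f0) -[leLHS]mulrA ff [leRHS]mulrAC ff.
have [h|h] := leP (1 - r%:R * r%:R / m%:R) (0 : R).
  apply: le_trans (_ : 0 <= _); last by rewrite mulr_ge0 ?exprn_ge0.
  by rewrite mulr_le0_ge0.
apply: le_trans (_ : (1 - r%:R * r%:R / m%:R) * (m * s)%:R ^+ r <= _).
  rewrite ler_wpM2l ?(ltW h) // -natrX ler_nat.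
  elim: r {rm f0 h ff} => [|r IH]; first by rewrite ffactn0.
  by rewrite ffactnSr expnSr leq_mul // leq_subr.
rewrite natrM exprMn mulrA ler_wpM2r ?exprn_ge0 // mulrC.
exact: ffact_ge.
Qed.

Lemma equal_parts (T : finType) n : exists V : 'I_n.+1 -> {set T},
  (forall i, #|V i| = #|T| %/ n.+1)%N /\ (forall i j x, x \in V i -> x \in V j -> i = j).
Proof.
pose k := (#|T| %/ n.+1)%N.
have [k0|k0] := posnP k.
  by exists (fun=> finset.set0); split => [i|i j x]; rewrite ?cards0 // inE.
have kT : (k * n.+1 <= #|T|)%N by rewrite leq_divM.
have rT (i : 'I_n.+1) (a : 'I_k) : (i * k + a < #|T|)%N.
  apply: leq_trans kT; have := ltn_ord i; have := ltn_ord a; nia.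
pose f (i : 'I_n.+1) (a : 'I_k) : T := enum_val (Ordinal (rT i a)).
have fE i a : nat_of_ord (enum_rank (f i a)) = (i * k + a)%N by rewrite enum_valK.
exists (fun i => [set f i a | a : 'I_k]%SET); split => [i|i j x].
  rewrite card_imset ?card_ord // => a b fab; apply: val_inj.
  by have := fE i a; rewrite fab fE => /addnI.
move=> /imsetP[a _ ->] /imsetP[b _ fab]; apply: val_inj.
have := fE i a; rewrite fab fE => /(congr1 (divn^~ k)).
by rewrite !divnMDl // !divn_small // !addn0.
Qed.

Lemma leq_double_divn N k : (0 < k)%N -> (2 * k <= N)%N -> (N <= 2 * k * (N %/ k))%N.
Proof.
move=> k0 kN; have := ltn_ceil N k0.
have : (0 < N %/ k)%N by rewrite divn_gt0 //; apply: leq_trans kN; rewrite leq_pmull.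
move: (N %/ k)%N => a; nia.
Qed.

Lemma locally_sparse_subset (R : realType) (r q m : nat) (F : r_graph r) (eta : R) :
  (3 <= r)%N -> (0 < q)%N -> (0 < m)%N -> 0 < eta ->
  quasi_linear F -> admits F (xzy_seq r) ->
  exists (b : R) (N : nat), 0 < b /\ forall H : r_graph r, (N <= #|vertex H|)%N ->
    ~ contains H F ->
    exists (S : {set vertex H}) (s : nat), [/\ (0 < s)%N, #|S| = (m * s)%N,
      b * #|vertex H|%:R <= #|S|%:R &
      (edges_in S)%:R + (1 - (1 / 4 + 1 / q%:R + eta)) * 'C(m, r)%:R * s%:R ^+ r
        <= 'C(m * s, r)%:R].
Proof.
move=> r3 q0 m0 eta0 qF [le [le_lin desc]].
have [M1 HM1] := @null_case R r q m r3 q0.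
pose m1 := maxn #|vertex F| M1.
(* The argument [1] means two colours, good and null. The size [m1] serves both outcomes: room for
   the vertices of [F], or for the second Ramsey selection. *)
have [n Hn] := ramsey (2 * r - 2) 1 m1.
pose K := (q.+1 ^ n.+1)%N.
have K0 : 0 < K%:R :> R by rewrite ltr0n expn_gt0.
pose D : R := 2 ^+ n.+2 * K%:R ^+ n.+1.
have D0 : 0 < D by rewrite mulr_gt0 // exprn_gt0.
pose c := Num.min 1 (eta / D).
have c0 : 0 < c by rewrite lt_min ltr01 divr_gt0.
have c1 : c <= 1 by rewrite ge_min lexx.
have cD : 2 ^+ n.+2 * c * K%:R ^+ n.+1 <= eta.
  by rewrite mulrAC -/D mulrC -ler_pdivlMr // ge_min lexx orbT.
pose ks := enum [set A : {set 'I_n.+1} | #|A| == (2 * r - 2)%N]%SET.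
have [th [th0 th1 Hth]] := @chain_exists R _ ks 1 c (enum_uniq _) ltr01 (lexx 1) c0 c1.
have n0 : 0 < n.+1%:R :> R by rewrite ltr0n.
(* The 4 is made of a factor 2 for rounding the part size and a factor 2 for rounding [s] down. *)
pose b : R := th / (4 * K%:R * n.+1%:R).
have b0 : 0 < b by rewrite divr_gt0 // !mulr_gt0.
exists b, (maxn (2 * n.+1) (Num.bound (b^-1)))%N; split => // H.
rewrite geq_max => /andP[N1 N2] noF.
have bN : 1 <= b * #|vertex H|%:R.
  rewrite mulrC -ler_pdivrMr // mul1r; apply: le_trans (_ : (Num.bound b^-1)%:R <= _).
    by rewrite ltW // archi_boundP // invr_ge0 ltW.
  by rewrite ler_nat.
have [V [cV disjV]] := equal_parts (vertex H) n.
pose n0' := (#|vertex H| %/ n.+1)%N.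
have n0'P : (#|vertex H| <= 2 * n.+1 * n0')%N.
  exact: leq_double_divn.
have n0'0 : (0 < n0')%N by rewrite divn_gt0 //; apply: leq_trans N1; rewrite leq_pmull.
have V0 : 0 < volume R V by apply: vol_gt0 => i; rewrite -card_gt0 cV.
have [X [Q [good [XV ch]]]] := Hth 'I_n.+1 (vertex H)
  (fun A => maps_edge (edges H) (block_fst r A)) (fun A => maps_edge (edges H) (block_snd r A))
  (@block_z1 r n) (@block_z2 r n) V V0.
have [XVs vXV] := XV.
have X0 : 0 < volume R X by apply: lt_le_trans vXV; rewrite mulr_gt0.
have disjX i j x : x \in X i -> x \in X j -> i = j.
  by move=> /(fintype.subsetP (XVs i)) xi /(fintype.subsetP (XVs j)); apply: disjV.
have Xi i : th * n0'%:R <= #|X i|%:R by rewrite -[n0'](cV i); apply: shrinks_part XV.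
pose s := Num.truncn (th * n0'%:R / K%:R).
have y2 : 2 * (b * #|vertex H|%:R) <= th * n0'%:R / K%:R.
  rewrite /b ler_pdivlMr //.
  have -> : 2 * (th / (4 * K%:R * n.+1%:R) * #|vertex H|%:R) * K%:R
     = th * (#|vertex H|%:R / (2 * n.+1%:R)).
    by field; rewrite !gt_eqF.
  rewrite ler_wpM2l ?(ltW th0) // ler_pdivrMr ?mulr_gt0 // mulrC -!natrM ler_nat.
  exact: n0'P.
have y0 : 0 <= th * n0'%:R / K%:R by apply: le_trans y2; lra.
have /andP[sy ys] := truncn_itv y0; rewrite -/s in sy ys.
have sb : b * #|vertex H|%:R <= s%:R by move: ys; rewrite -natr1; lra.
have s0 : (0 < s)%N by rewrite -(ltr0n R); apply: lt_le_trans sb; lra.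
have sX i : (s * q.+1 ^ n.+1 <= #|X i|)%N.
  rewrite -(ler_nat R) natrM; apply: le_trans (Xi i).
  by rewrite -ler_pdivlMr.
pose col (A : {set 'I_n.+1}) : 'I_2 := if good A then ord_max else ord0.
have [|J [_ cJ [cc Hcc]]] := Hn _ [set: 'I_n.+1]%SET col; first by rewrite cardsT card_ord.
have [ccE|ccE] := eqVneq cc ord_max.
  case: noF; apply: (@good_case r n F le J le_lin _ R H X Q good ks c) => //.
  - by rewrite cJ leq_maxl.
  - exact: ltnW.
  - exact: enum_uniq.
  move=> A AJ cA; rewrite mem_enum inE cA eqxx /=.
  by have := Hcc A AJ cA; rewrite ccE /col; case: (good A) => // /(congr1 val).
have [||S [cS HS]] := HM1 n s (vertex H) (edges H) Q c J X (ltW c0) s0 _ disjX sX.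
- by rewrite cJ leq_maxr.
- move=> A AJ cA; apply: (chain_null c0 ch).
    by rewrite mem_enum inE cA.
  by have := Hcc A AJ cA; apply: contraPN; rewrite /col => ->; apply/nesym/eqP.
exists S, s; split => //.
  by rewrite cS (le_trans sb) // ler_nat leq_pmull.
have eS : edges_in S = #|[set e in edges H | (#|e| == r) && (e \subset S)]%SET|.
  apply: eq_card => e; rewrite !inE; have [eH|//] := boolP (e \in edges H).
  by rewrite (r_graph_uniform eH) eqxx.
rewrite eS; apply: le_trans HS.
rewrite lerD2l -[leLHS]mulrA -[leRHS]mulrA ler_wpM2r ?mulr_ge0 ?exprn_ge0 //.
by apply: lerB => //; rewrite lerD2l.
Qed.

Lemma density_le_quarter (R : realType) (r : nat) (F : r_graph r) (d : R) :
  (3 <= r)%N -> quasi_linear F -> admits F (xzy_seq r) ->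
  avoidable_density F d -> d <= 1 / 4.
Proof.
move=> r3 qF aF [H [[[eps [eps0 dens]] Hoo] noF]].
rewrite leNgt; apply/negP => d4.
pose g := d - 1 / 4.
have g0 : 0 < g by rewrite subr_gt0.
(* Error budget: 1/q, [eta] and the share r^2/m of non-transversal sets are each at most g/8. They
   leave a density of at most 1/4 + g/4 + 3g/32, below the 1/4 + g/2 that remains of [d] once [eps]
   is at most g/2. *)
pose q := (Num.bound (8 / g)).+1.
have qg : 1 / q%:R <= g / 8.
  rewrite ler_pdivrMr ?ltr0n // -ler_pdivrMl ?divr_gt0 // mulr1 invf_div.
  rewrite ltW //; apply: lt_le_trans (archi_boundP _) _; first by rewrite divr_ge0 // ltW.
  by rewrite ler_nat.
pose m := (r + Num.bound (8 * r%:R * r%:R / g))%N.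
have m0 : (0 < m)%N by rewrite /m; lia.
have M0 : 0 < m%:R :> R by rewrite ltr0n.
have rm : (r <= m)%N by rewrite leq_addr.
have mg : r%:R * r%:R / m%:R <= g / 8.
  rewrite ler_pdivrMr //.
  have : 8 * r%:R * r%:R / g <= m%:R.
    apply: le_trans (ltW (archi_boundP _)) _; first by rewrite divr_ge0 ?mulr_ge0 // ltW.
    by rewrite ler_nat leq_addl.
  rewrite ler_pdivrMr //; nra.
have g80 : 0 < g / 8 by rewrite divr_gt0.
have [b [N [b0 HN]]] := locally_sparse_subset r3 (ltn0Sn _ : (0 < q)%N) m0 g80 qF aF.
have e1 : 0 < Num.min b (g / 2) by rewrite lt_min b0 divr_gt0.
move/cvgrPdist_lt: eps0 => /(_ _ e1) ev1.
move/cvgnyPge: Hoo => /(_ N) ev2.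
have [k [ek Nk]] := filter_ex (filterI ev1 ev2).
move: ek; rewrite /= sub0r normrN lt_min => /andP[eb eg].
have [S [s [s0 cS bS HS]]] := HN (H k) Nk (noF k).
have epsb : eps k <= b by apply: le_trans (ler_norm _) (ltW eb).
have epsg : eps k <= g / 2 by apply: le_trans (ler_norm _) (ltW eg).
have := dens k S; rewrite cS => dS.
have {}dS : (d - eps k) * 'C(m * s, r)%:R <= (edges_in S)%:R.
  apply: dS; rewrite -cS; apply: le_trans bS; by rewrite ler_wpM2r.
have [B1 B2] := bin_blowup R s rm m0.
have T0 : 0 < 'C(m * s, r)%:R :> R.
  by rewrite ltr0n bin_gt0; apply: leq_trans rm _; rewrite leq_pmulr.
have Q0 : 0 <= 'C(m, r)%:R * s%:R ^+ r :> R by rewrite mulr_ge0 // exprn_ge0.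
move: HS; rewrite -mulrA; move: dS B1 B2 T0 Q0.
move: ('C(m * s, r)%:R) ('C(m, r)%:R * _) (edges_in S)%:R => Tot Qn e dS B1 B2 T0 Q0 HS.
have h1 : (1 - g / 8) * Tot <= Qn.
  by apply: le_trans B1; rewrite ler_wpM2r ?(ltW T0) // lerB.
have h2 : (1 / q%:R + g / 8) * Qn <= (g / 4) * Tot.
  apply: ler_pM => //; first by rewrite addr_ge0 ?divr_ge0 // ltW.
  by move: qg; lra.
have h3 : (d - g / 2) * Tot <= e by apply: le_trans dS; rewrite ler_wpM2r ?(ltW T0) // lerB.
have h4 : 0 < g * Tot by rewrite mulr_gt0.
have dE : d = g + 1 / 4 by rewrite subrK.
rewrite dE in h3; clear -h1 h2 h3 h4 HS T0; lra.
Qed.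

(** * The lower bound *)

(** With y = 2x^2 - x, exp(-y) is at most 1/(1 + y), and (1 + x)(1 + y) = 1 + x^2(1 + 2x) is at
    least 1. *)
Lemma expR_le1Dx (R : realType) (x : R) : - (1 / 2) <= x -> expR (x - 2 * x ^+ 2) <= 1 + x.
Proof.
move=> x2; have -> : x - 2 * x ^+ 2 = - (2 * x ^+ 2 - x) by ring.
rewrite expRN -[leLHS]mul1r ler_pdivrMr ?expR_gt0 //.
have h : 1 + (2 * x ^+ 2 - x) <= expR (2 * x ^+ 2 - x) := expR_ge1Dx _.
have x1 : 0 <= 1 + x by lra.
apply: le_trans (ler_wpM2l x1 h).
by have := mulr_ge0 (sqr_ge0 x) (_ : 0 <= 1 + 2 * x); rewrite !expr2; nra.
Qed.

Section RandomColouring.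
Variables (R : realType) (N : nat).
Implicit Types (chi : {ffun 'I_N * 'I_N -> bool}) (A B : {set 'I_N}).

Definition sign (b : bool) : R := if b then 1 else - 1.

Lemma norm_sign b : `|sign b| = 1.
Proof. by case: b; rewrite /sign ?normrN normr1. Qed.

Definition discrepancy chi A B : R :=
  \sum_(p : 'I_N * 'I_N | [&& p.1 \in A, p.2 \in B & (p.1 < p.2)%N]) sign (chi p).

(** One factor of an exponential moment of the discrepancy, [s] being the sign of the deviation. Its
    values at the two colours average to 1, so the product over all pairs averages to 1 over all
    colourings. *)
Definition pair_weight (d : R) A B (s : bool) (p : 'I_N * 'I_N) (b : bool) : R :=
  if [&& p.1 \in A, p.2 \in B & (p.1 < p.2)%N] then 1 + d * sign s * sign b else 1.

Lemma sum_weight (d : R) A B s :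
  \sum_(chi : {ffun 'I_N * 'I_N -> bool}) \prod_p pair_weight d A B s p (chi p) =
  #|{ffun 'I_N * 'I_N -> bool}|%:R.
Proof.
rewrite -(bigA_distr_bigA (fun p b => pair_weight d A B s p b)) /=.
rewrite (eq_bigr (fun=> 2)); last first.
  by move=> p _; rewrite big_bool /pair_weight; case: ifP => _ /=; ring.
by rewrite prodr_const card_ffun card_bool natrX.
Qed.

Lemma weight_ge (d : R) A B s chi : 0 <= d -> d <= 1 / 2 ->
  expR (d * sign s * discrepancy chi A B - 2 * d ^+ 2 * N%:R ^+ 2)
    <= \prod_p pair_weight d A B s p (chi p).
Proof.
move=> d0 d2.
pose x p : R := if [&& p.1 \in A, p.2 \in B & (p.1 < p.2)%N] then d * sign s * sign (chi p) else 0.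
have xd p : `|x p| <= d.
  rewrite /x; case: ifP => _; last by rewrite normr0.
  by rewrite !normrM (ger0_norm d0) !norm_sign !mulr1.
apply: le_trans (_ : \prod_p expR (x p - 2 * x p ^+ 2) <= _); last first.
  apply: ler_prod => p _; rewrite expR_ge0 /=.
  apply: le_trans (expR_le1Dx _) _.
    by have := xd p; rewrite ler_norml => /andP[h _]; apply: le_trans h; rewrite lerN2.
  by rewrite /x /pair_weight; case: ifP => //; rewrite addr0.
rewrite -expR_sum ler_expR sumrB; apply: lerB.
  by rewrite /discrepancy mulr_sumr [leLHS]big_mkcond.
apply: le_trans (_ : \sum_(p : 'I_N * 'I_N) 2 * d ^+ 2 <= _).
  apply: ler_sum => p _; rewrite ler_pM2l // -[x p ^+ 2]real_normK ?num_real //.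
  by rewrite lerXn2r ?nnegrE // normr_ge0.
rewrite sumr_const card_prod card_ord -[leLHS]mulr_natr natrM expr2.
by [].
Qed.

End RandomColouring.

(** The weights of all triples (A, B, s) sum on average to their number, 2 * 4^N, so some colouring
    does not exceed it. For that colouring, a discrepancy above the bound would give a single weight
    above 2 * 4^N. *)
Lemma random_colouring (R : realType) (eta : R) : 0 < eta -> eta <= 1 ->
  exists N0 : nat, forall N : nat, (N0 <= N)%N ->
    exists chi : {ffun 'I_N * 'I_N -> bool}, forall A B : {set 'I_N},
      `|discrepancy R chi A B| <= 2 * eta * N%:R ^+ 2.
Proof.
move=> eta0 eta1.
(* With 14, the exponent per vertex, eta^2 N / 2, is at least 7, so each exponential factor is at
   least 1 + 7 = 8. The final [.+2] gives N > 1, hence 2 * 4^N < 8^N. *)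
exists (Num.bound (14 / eta ^+ 2)).+2 => N NN.
have N1 : (1 < N)%N by apply: leq_trans NN.
have N0 : (0 < N)%N by apply: ltnW.
have NE : 14 / eta ^+ 2 <= N%:R.
  apply: le_trans (ltW (archi_boundP _)) _; first by rewrite divr_ge0 // exprn_ge0 // ltW.
  by rewrite ler_nat; exact: leq_trans (leqW (leqnSn _)) NN.
pose d : R := eta / 2.
have d0 : 0 <= d by rewrite divr_ge0 // ltW.
have d2 : d <= 1 / 2 by rewrite /d; lra.
pose Z (chi : {ffun 'I_N * 'I_N -> bool}) (k : {set 'I_N} * {set 'I_N} * bool) : R :=
  \prod_p pair_weight d k.1.1 k.1.2 k.2 p (chi p).
have Z0 chi k : 0 <= Z chi k by apply: le_trans (weight_ge _ _ _ _ d0 d2); exact: expR_ge0.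
pose K := #|{: {set 'I_N} * {set 'I_N} * bool}|.
have KE : K%:R = 2 * 4 ^+ N :> R.
  rewrite /K !card_prod card_bool.
  have -> : #|{: {set 'I_N}}| = (2 ^ N)%N.
    by rewrite -cardsT -powersetT card_powerset cardsT card_ord.
  by rewrite !natrM natrX mulrC -exprMn; congr (_ * _ ^+ _); ring.
have [chi Hchi] : exists chi, \sum_k Z chi k <= K%:R.
  apply/not_existsP => H.
  have : \sum_(chi : {ffun 'I_N * 'I_N -> bool}) \sum_k Z chi k =
    K%:R * #|{ffun 'I_N * 'I_N -> bool}|%:R.
    rewrite exchange_big /= (eq_bigr (fun=> #|{ffun 'I_N * 'I_N -> bool}|%:R)).
      by rewrite sumr_const mulr_natl.
    by move=> k _; exact: sum_weight.
  apply/eqP; rewrite gt_eqF // mulr_natr -sumr_const.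
  apply: ltr_sum; first by apply/hasP; exists [ffun=> true]; rewrite // mem_index_enum.
  by move=> chi _; rewrite ltNge; apply/negP/H.
exists chi => A B.
have bound s : sign R s * discrepancy R chi A B <= 2 * eta * N%:R ^+ 2.
  rewrite leNgt; apply/negP => big.
  have : Z chi (A, B, s) <= K%:R.
    apply: le_trans Hchi; rewrite (bigD1 (A, B, s)) //= lerDl sumr_ge0 //.
  rewrite leNgt => /negP[]; apply: lt_le_trans (weight_ge _ _ _ _ d0 d2).
  have e2 : N%:R * (eta ^+ 2 * N%:R / 2) <
     d * sign R s * discrepancy R chi A B - 2 * d ^+ 2 * N%:R ^+ 2.
    have e0 : 0 < eta / 2 by rewrite divr_gt0.
    have h : d * (2 * eta * N%:R ^+ 2) < d * (sign R s * discrepancy R chi A B).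
      by rewrite ltr_pM2l.
    have -> : N%:R * (eta ^+ 2 * N%:R / 2) =
       d * (2 * eta * N%:R ^+ 2) - 2 * d ^+ 2 * N%:R ^+ 2 by rewrite /d; field.
    by rewrite ltrD2r -[ltRHS]mulrA.
  apply: lt_trans (_ : expR (N%:R * (eta ^+ 2 * N%:R / 2)) < _); last by rewrite ltr_expR.
  rewrite expRM_natl KE; apply: lt_le_trans (_ : 8 ^+ N <= _).
    have -> : 8 = 2 * 4 :> R by ring.
    rewrite exprMn ltr_pM2r ?exprn_gt0 // -[ltLHS]expr1 ltr_eXn2l ?ltr1n //.
  rewrite lerXn2r ?nnegrE ?expR_ge0 //; apply: le_trans (expR_ge1Dx _).
  by move: NE; rewrite ler_pdivrMr ?exprn_gt0 //; lra.
rewrite ler_norml; apply/andP; split.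
  by have := bound false; rewrite /sign mulN1r lerNl.
by have := bound true; rewrite /sign mul1r.
Qed.

(** * The graph of red heads and blue tails *)

Section HeadTailGraph.
Variables (r n : nat) (chi : {ffun 'I_n.+1 * 'I_n.+1 -> bool}).

Definition head_tail_edges : {set {set 'I_n.+1}} :=
  [set e : {set 'I_n.+1} | let a := nth ord0 (enum e) in
    [&& #|e| == r, chi (a 0%N, a 1%N) & ~~ chi (a (r - 2)%N, a (r - 1)%N)]]%SET.

Lemma head_tail_uniform : is_uniform r (Hypergraph head_tail_edges).
Proof. by move=> e; rewrite inE => /and3P[/eqP]. Qed.

Definition head_tail_graph : r_graph r := RGraph head_tail_uniform.

Lemma head_tail_free (F : r_graph r) : (3 <= r)%N -> head_tail_mixing F ->
  ~ contains head_tail_graph F.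
Proof.
move=> r3 mix [phi [phi_inj phiE]].
(* Mixing is applied to the order pulled back from the host, for which [phi] carries heads to heads
   and tails to tails. *)
pose le (u v : vertex F) := (phi u <= phi v)%N.
have le_lin : linear_order le.
  split; rewrite /le.
  - by move=> u; apply: leqnn.
  - by move=> u v; rewrite -eqn_leq => /eqP/val_inj/phi_inj.
  - by move=> v u w; apply: leq_trans.
  - by move=> u v; apply: leq_total.
have phi_lt u v : le u v -> u != v -> (phi u < phi v)%N.
  rewrite /le => uv nuv; rewrite ltn_neqAle uv andbT.
  by apply: contraNneq nuv => /val_inj/phi_inj ->.
have [e [f [eF fF hef]]] := mix le le_lin.
have enumE A := enum_imset_sorted A le_lin phi_lt.
have imtake (s : seq (vertex F)) :
    [set phi x | x in [set x in s]]%SET = [set k in map phi s]%SET.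
  apply/setP => k; rewrite inE; apply/imsetP/mapP => -[v vs ->]; exists v => //.
    by rewrite inE in vs.
  by rewrite inE.
have hd : enum [set phi x | x in edge_head le e]%SET = take 2 (enum [set phi x | x in e]%SET).
  rewrite /edge_head imtake map_take -enumE; apply: enum_set_sorted.
  by apply: take_sorted; apply: enum_ord_sorted.
have tl : enum [set phi x | x in edge_tail le f]%SET =
    drop (r - 2) (enum [set phi x | x in f]%SET).
  rewrite /edge_tail imtake map_drop -enumE (r_graph_uniform fF); apply: enum_set_sorted.
  by apply: drop_sorted; apply: enum_ord_sorted.
have /(_ e eF) := phiE; have /(_ f fF) := phiE.
rewrite !inE => /and3P[_ _ nchi] /and3P[_ chi_e _].
move: nchi chi_e; rewrite hef tl in hd.
have nth_tl l : nth ord0 (enum [set phi x | x in f]%SET) ((r - 2) + l) =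
    nth ord0 (take 2 (enum [set phi x | x in e]%SET)) l.
  by rewrite -hd nth_drop.
have -> : (r - 1 = (r - 2) + 1)%N by lia.
by have := nth_tl 0%N; rewrite addn0 => ->; rewrite nth_tl !nth_take // => /negP.
Qed.

End HeadTailGraph.

(** * Sets of size r = k + 3 as increasing tuples *)

Section Increasing.
Variables (k M : nat).
Implicit Types (t u : {ffun 'I_k.+3 -> 'I_M.+1}).

Definition increasing t : bool := 
  [forall i : 'I_k.+3, forall j : 'I_k.+3, (i < j)%N ==> (t i < t j)%N].

Lemma increasingP t : reflect (forall i j : 'I_k.+3, (i < j)%N -> (t i < t j)%N) (increasing t).
Proof.
apply: (iffP forallP) => [H i j ij|H i]; first by have /forallP/(_ j)/implyP := H i; apply.
by apply/forallP => j; apply/implyP; apply: H.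
Qed.

Lemma enum_increasing t : increasing t -> enum [set t i | i : 'I_k.+3]%SET = map t (enum 'I_k.+3).
Proof.
move=> /increasingP tinc.
have -> : [set t i | i : 'I_k.+3]%SET = [set x in map t (enum 'I_k.+3)]%SET.
  apply/setP => x; rewrite inE; apply/imsetP/mapP => -[i _ ->]; exists i => //.
  by rewrite mem_enum.
apply: enum_set_sorted; rewrite sorted_map.
apply: sub_sorted (_ : sorted (fun i j : 'I_k.+3 => i < j)%N _) => //.
have := iota_ltn_sorted 0 k.+3; rewrite -val_enum_ord sorted_map.
by [].
Qed.

Lemma nth_increasing t (i : 'I_k.+3) : increasing t ->
  nth ord0 (enum [set t i | i : 'I_k.+3]%SET) i = t i.
Proof.
move=> tinc; rewrite enum_increasing // (nth_map ord0) ?nth_ord_enum //.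
by rewrite size_enum_ord.
Qed.

Lemma card_increasing (P : pred {set 'I_M.+1}) :
  #|[set t : {ffun 'I_k.+3 -> 'I_M.+1} | increasing t && P [set t i | i : 'I_k.+3]%SET]%SET| =
  #|[set e : {set 'I_M.+1} | (#|e| == k.+3) && P e]%SET|.
Proof.
rewrite -(card_in_imset (f := fun t : {ffun 'I_k.+3 -> 'I_M.+1} => [set t i | i : 'I_k.+3]%SET)).
  apply: eq_card => e; rewrite inE; apply/imsetP/andP => [[t]|[/eqP ce Pe]].
    rewrite inE => /andP[tinc Pt] ->; split => //.
    by rewrite cardE enum_increasing // size_map size_enum_ord.
  have se : size (enum e) = k.+3 by rewrite -cardE.
  pose t := [ffun i : 'I_k.+3 => nth ord0 (enum e) i].
  have et : e = [set t i | i : 'I_k.+3]%SET.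
    apply/setP => x; rewrite -mem_enum; apply/(nthP ord0)/imsetP => [[i]|[i _ ->]].
      by rewrite se => ik <-; exists (Ordinal ik); rewrite ?ffunE.
    by exists i; rewrite ?se // ffunE.
  exists t => //; rewrite inE -et Pe andbT; apply/increasingP => i j ij; rewrite !ffunE.
  by apply: (sorted_ltn_nth (@ord_ltn_trans M.+1) ord0 (enum_ord_sorted e)); rewrite ?inE ?se.
move=> t u; rewrite !inE => /andP[tinc _] /andP[uinc _] tu.
by apply/ffunP => i; rewrite -(nth_increasing _ tinc) tu nth_increasing.
Qed.

End Increasing.

(** * Density of the head-tail graph from small discrepancy *)

Section Density.
Variables (R : realType) (k M : nat) (chi : {ffun 'I_M.+1 * 'I_M.+1 -> bool}) (D : R).
Implicit Types (t u : {ffun 'I_k.+3 -> 'I_M.+1}) (S : {set 'I_M.+1}).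

Hypothesis disc_chi : forall A B : {set 'I_M.+1},
  `|discrepancy R chi A B| <= D * M.+1%:R ^+ 2.

Let V : 'I_k.+3 -> {set 'I_M.+1} := fun=> [set: 'I_M.+1]%SET.

Lemma vol_full : volume R V = M.+1%:R ^+ k.+3.
Proof.
rewrite volE (eq_bigr (fun=> M.+1%:R)) ?prodr_const ?card_ord // => i _.
by rewrite cardsT card_ord.
Qed.

Lemma sum_two_coords (i j : 'I_k.+3) (f : 'I_M.+1 -> 'I_M.+1 -> R) : i != j ->
  (\sum_(u in box V) f (u i) (u j)) * M.+1%:R ^+ 2 =
  volume R V * \sum_(p : 'I_M.+1 * 'I_M.+1) f p.1 p.2.
Proof.
move=> ij; have cV l : #|V l| = M.+1 by rewrite cardsT card_ord.
have pairE (a b : 'I_M.+1) :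
    count_in R V (fun u => (u j == b) && (u i \in [set a]%SET)) * M.+1%:R ^+ 2 = volume R V.
  have aV : [set a]%SET \subset V i by apply: finset.subsetT.
  rewrite -(cnt_set_part R (fun u => u j == b) aV).
  have := cnt_coord R (set_part V i [set a]%SET) j (fun x => x == b).
  have -> : set_part V i [set a]%SET j = V j by rewrite /set_part eq_sym (negPf ij).
  rewrite cV (_ : #|[set x in V j | x == b]%SET| = 1%N); last first.
    by apply/eqP/cards1P; exists b; apply/setP => x; rewrite !inE.
  rewrite expr2 mulrA => ->; rewrite mul1r.
  by have := vol_set_part R V i [set a]%SET; rewrite cV cards1 mul1r.
have -> : \sum_(u in box V) f (u i) (u j) = \sum_(p : 'I_M.+1 * 'I_M.+1)
   f p.1 p.2 * count_in R V (fun u => (u j == p.2) && (u i \in [set p.1]%SET)).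
  under [RHS]eq_bigr do rewrite cntE mulr_sumr.
  rewrite exchange_big /=; apply: eq_bigr => u _.
  rewrite (bigD1 (u i, u j)) //= inE !eqxx mulr1 big1 ?addr0 // => -[a b] /= ab.
  rewrite inE; case: eqP => [ujb|]; last by rewrite mulr0.
  case: eqP => [uia|]; last by rewrite mulr0.
  by rewrite uia ujb eqxx in ab.
rewrite mulr_suml mulr_sumr; apply: eq_bigr => p _.
by rewrite -mulrA pairE mulrC.
Qed.

Lemma resample_disc (i j : 'I_k.+3) (P : {ffun 'I_k.+3 -> 'I_M.+1} -> bool) : i != j ->
  (forall t, exists A B : {set 'I_M.+1}, forall u,
     P (splice [set i; j]%SET t u) = [&& u i \in A, u j \in B & (u i < u j)%N]) ->
  `|\sum_(t in box V) (P t)%:R * sign R (chi (t i, t j))| <= D * volume R V.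
Proof.
move=> ij HP.
have M0 : 0 < M.+1%:R ^+ 2 :> R by rewrite exprn_gt0.
have V0 : 0 < volume R V by rewrite vol_full exprn_gt0.
rewrite -(ler_pM2l V0) -{1}(gtr0_norm V0) -normrM.
rewrite -(sum_splice (g := [set i; j]%SET) (V := V) (X := V)) //.
apply: le_trans (ler_norm_sum _ _ _) _.
rewrite [leRHS]mulrC -[leRHS]sum_box_const.
apply: ler_sum => t _; have [A [B HAB]] := HP t.
rewrite (eq_bigr (fun u => (fun a b => ([&& a \in A, b \in B & (a < b)%N])%:R
   * sign R (chi (a, b))) (u i) (u j))); last first.
  by move=> u _; rewrite HAB !ffunE !inE !eqxx orbT.
rewrite -(ler_pM2r M0) -{1}(gtr0_norm M0) -normrM.
rewrite (sum_two_coords (fun a b => ([&& a \in A, b \in B & (a < b)%N])%:R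
   * sign R (chi (a, b))) ij).
rewrite normrM (gtr0_norm V0) mulrAC mulrC ler_wpM2r ?vol_ge0 //.
apply: le_trans (disc_chi A B); rewrite le_eqVlt; apply/orP; left; apply/eqP; congr `|_|.
rewrite /discrepancy [RHS]big_mkcond; apply: eq_bigr => -[a b] _ /=.
by case: ifP => _; rewrite ?mul1r ?mul0r.
Qed.

Let i0 : 'I_k.+3 := ord0.
Let i1 : 'I_k.+3 := inord 1.
Let j0 : 'I_k.+3 := inord k.+1.
Let j1 : 'I_k.+3 := ord_max.

Lemma i1E : i1 = 1%N :> nat. Proof. by rewrite inordK. Qed.
Lemma j0E : j0 = k.+1 :> nat. Proof. by rewrite inordK. Qed.

Definition chain_in S t : bool := [forall i, t i \in S] && increasing t.

Lemma chain_inP S t :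
  reflect ((forall i, t i \in S) /\ (forall i j : 'I_k.+3, (i < j)%N -> (t i < t j)%N))
  (chain_in S t).
Proof. by apply: (iffP andP) => -[/forallP tS /increasingP]. Qed.

Lemma tail_disc S :
  `|\sum_(t in box V) (chain_in S t)%:R * sign R (chi (t j0, t j1))| <= D * volume R V.
Proof.
have j01 : j0 != j1 by rewrite -val_eqE /= j0E; apply/eqP; lia.
apply: resample_disc => // t.
pose t' a : {ffun 'I_k.+3 -> 'I_M.+1} := [ffun l => if l == j0 then a else t l].
(* The last vertex only has to lie in [S] above the one at [j0]; every other constraint bears on the
   vertex at [j0] alone and is collected in [A]. *)
pose A := [set a in S | [forall l : 'I_k.+3, (l != j1) ==> (t' a l \in S)] &&
  [forall l : 'I_k.+3, forall l' : 'I_k.+3,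
    [&& l' != j1 & (l < l')%N] ==> (t' a l < t' a l')%N]]%SET.
exists A, S => u.
have E l : l != j1 -> splice [set j0; j1]%SET t u l = t' (u j0) l.
  by move=> /negPf lj; rewrite !ffunE !inE lj orbF; case: eqP => // ->.
have E1 : splice [set j0; j1]%SET t u j1 = u j1 by rewrite ffunE !inE eqxx orbT.
have E0 : splice [set j0; j1]%SET t u j0 = u j0 by rewrite ffunE !inE eqxx.
have lt_j1 (l : 'I_k.+3) : l != j1 -> (l < j1)%N.
  by move=> lj; rewrite ltn_neqAle -val_eqE in lj *; rewrite lj -ltnS ltn_ord.
apply/chain_inP/and3P => [[uS uinc]|[]].
  split; first last.
  - by rewrite -E0 -E1; apply: uinc; apply: lt_j1.
  - by rewrite -E1.
  have u0S : u j0 \in S by rewrite -E0.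
  rewrite inE u0S /=; apply/andP; split.
    by apply/forallP => l; apply/implyP => lj; rewrite -E.
  apply/forallP => l; apply/forallP => l'; apply/implyP => /andP[lj' ll'].
  rewrite -!E //; first exact: uinc.
  by apply: contraTneq ll' => ->; rewrite -leqNgt -ltnS ltn_ord.
rewrite inE => /and3P[u0S /forallP HS /forallP Hinc] u1S u01.
have inc' (l l' : 'I_k.+3) : l' != j1 -> (l < l')%N -> (t' (u j0) l < t' (u j0) l')%N.
  by move=> lj' ll'; have /forallP/(_ l') := Hinc l; rewrite lj' ll'.
split => [l|l l' ll'].
  have [->|lj] := eqVneq l j1; first by rewrite E1.
  by rewrite E //; have := HS l; rewrite lj.
have lj : l != j1.
  by apply: contraTneq ll' => ->; rewrite -leqNgt -ltnS ltn_ord.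
rewrite E //; have [->|lj'] := eqVneq l' j1; last by rewrite E // inc'.
rewrite E1; have [->|lj0] := eqVneq l j0; first by rewrite ffunE eqxx.
have tj0 : t' (u j0) j0 = u j0 by rewrite ffunE eqxx.
apply: ltn_trans u01; apply: leq_trans (inc' l j0 j01 _) _; last by rewrite tj0.
have := lt_j1 l lj; rewrite /= ltnS leq_eqVlt j0E.
by case/predU1P => // lk; rewrite -val_eqE /= j0E lk eqxx in lj0.
Qed.

Lemma head_disc S : `|\sum_(t in box V) (chain_in S t && ~~ chi (t j0, t j1))%:R *
  sign R (chi (t i0, t i1))| <= D * volume R V.
Proof.
have i01 : i0 != i1 by rewrite -val_eqE /= i1E.
apply: resample_disc => // t.
pose t' b : {ffun 'I_k.+3 -> 'I_M.+1} := [ffun l => if l == i1 then b else t l].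
(* For r = 3 the index [i1] is [j0], so the colour of the tail changes with the resampled vertex at
   [i1]. It never involves the one at [i0], hence it can be absorbed into [B]. *)
pose B := [set b in S | [&& [forall l : 'I_k.+3, (l != i0) ==> (t' b l \in S)],
  [forall l : 'I_k.+3, forall l' : 'I_k.+3, (l != i0) && (l < l')%N ==> (t' b l < t' b l')%N] &
  ~~ chi (t' b j0, t' b j1)]]%SET.
exists S, B => u.
have E l : l != i0 -> splice [set i0; i1]%SET t u l = t' (u i1) l.
  by move=> /negPf li; rewrite !ffunE !inE li /=; case: eqP => // ->.
have E0 : splice [set i0; i1]%SET t u i0 = u i0 by rewrite ffunE !inE eqxx.
have E1 : splice [set i0; i1]%SET t u i1 = u i1 by rewrite ffunE !inE eqxx orbT.
have j0i : j0 != i0 by rewrite -val_eqE /= j0E.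
have j1i : j1 != i0 by [].
have gt_i0 (l : 'I_k.+3) : l != i0 -> (i0 < l)%N by rewrite -val_eqE /= lt0n.
have gt_neq (l l' : 'I_k.+3) : (l < l')%N -> l' != i0.
  by move=> ll'; rewrite -val_eqE /= -lt0n; apply: leq_ltn_trans ll'.
rewrite !E //; apply/andP/and3P => [[/chain_inP[uS uinc] nchi]|[]].
  split; first by rewrite -E0.
  - have u1S : u i1 \in S by rewrite -E1.
    rewrite inE u1S nchi andbT /=; apply/andP; split.
      by apply/forallP => l; apply/implyP => lj; rewrite -E.
    apply/forallP => l; apply/forallP => l'; apply/implyP => /andP[lj' ll'].
    by rewrite -!E //; [exact: uinc|exact: gt_neq ll'].
  - by rewrite -E0 -E1; apply: uinc; apply: gt_i0; rewrite eq_sym.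
rewrite inE => u0S /and4P[u1S /forallP HS /forallP Hinc nchi] u01; split => //.
have inc' (l l' : 'I_k.+3) : l != i0 -> (l < l')%N -> (t' (u i1) l < t' (u i1) l')%N.
  by move=> lj ll'; have /forallP/(_ l') := Hinc l; rewrite lj ll'.
apply/chain_inP; split => [l|l l' ll'].
  have [->|lj] := eqVneq l i0; first by rewrite E0.
  by rewrite E //; have := HS l; rewrite lj.
have lj' := gt_neq _ _ ll'.
rewrite [in X in (_ < X)%N]E //; have [li|lj] := eqVneq l i0; last by rewrite E // inc'.
rewrite li E0; have [->|l1] := eqVneq l' i1; first by rewrite ffunE eqxx.
have ti1 : t' (u i1) i1 = u i1 by rewrite ffunE eqxx.
apply: ltn_trans u01 _; apply: leq_trans (inc' i1 l' _ _); first by rewrite ti1.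
  by rewrite eq_sym.
by rewrite i1E ltn_neqAle lt0n eq_sym -{1}i1E !val_eqE l1 lj'.
Qed.

Lemma edges_head_tail S :
  (edges_in (S : {set vertex (head_tail_graph k.+3 chi)}))%:R =
  \sum_(t in box V) ((chain_in S t && ~~ chi (t j0, t j1)) && chi (t i0, t i1))%:R :> R.
Proof.
pose P (e : {set 'I_M.+1}) := let a := nth ord0 (enum e) in
  [&& e \subset S, chi (a 0%N, a 1%N) & ~~ chi (a k.+1, a k.+2)].
have -> : edges_in (S : {set vertex (head_tail_graph k.+3 chi)}) =
    #|[set e : {set 'I_M.+1} | (#|e| == k.+3) && P e]%SET|.
  apply: eq_card => e; rewrite !inE /P /= !subSS subn0.
  by case: (#|e| == k.+3) => //=; rewrite andbC.
rewrite -card_increasing -sum1_card natr_sum [LHS]big_mkcond [RHS]big_mkcond.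
apply: eq_bigr => t _; rewrite inE.
have -> : t \in box V by apply/in_box => i; rewrite inE.
have -> : increasing t && P [set t i | i : 'I_k.+3]%SET =
   (chain_in S t && ~~ chi (t j0, t j1)) && chi (t i0, t i1).
  rewrite /chain_in; case: (boolP (increasing t)) => tinc; last by rewrite andbF.
  have nthE i := nth_increasing i tinc.
  rewrite /P /=; have := nthE i0; rewrite /= => ->.
  have := nthE i1; rewrite i1E => ->; have := nthE j0; rewrite j0E => ->.
  have := nthE j1; rewrite /= => ->; rewrite andbT -andbA; congr (_ && _).
    apply/fintype.subsetP/forallP => [H i|H x /imsetP[i _ ->] //].
    by apply: H; apply: imset_f.
  by rewrite andbC.
by case: (_ && _).
Qed.

Lemma sum_chain_in S : \sum_(t in box V) (chain_in S t)%:R = 'C(#|S|, k.+3)%:R :> R.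
Proof.
rewrite -cards_draws.
have -> : #|[set B : {set 'I_M.+1} | (B \subset S) && (#|B| == k.+3)]%SET| =
   #|[set e : {set 'I_M.+1} | (#|e| == k.+3) && (e \subset S)]%SET|.
  by apply: eq_card => e; rewrite !inE andbC.
rewrite -(card_increasing k (fun e : {set 'I_M.+1} => e \subset S)) -sum1_card natr_sum.
rewrite [RHS]big_mkcond [LHS]big_mkcond; apply: eq_bigr => t _; rewrite inE.
have -> : t \in box V by apply/in_box => i; rewrite inE.
rewrite /chain_in andbC; case: (increasing t) => //=.
have -> : [forall i, t i \in S] = ([set t i | i : 'I_k.+3]%SET \subset S).
  apply/forallP/fintype.subsetP => [H x /imsetP[i _ ->] //|H i].
  by apply: H; apply: imset_f.
by case: (_ \subset _).
Qed.

(** Each colour condition is written as (1 + sign)/2 or (1 - sign)/2. Expanding first at the head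
    and then at the tail gives a quarter of all sets, with errors D/2 and D/4 relative to the
    volume. *)
Lemma edges_head_tail_ge S : 'C(#|S|, k.+3)%:R / 4 - D * M.+1%:R ^+ k.+3 <=
  (edges_in (S : {set vertex (head_tail_graph k.+3 chi)}))%:R :> R.
Proof.
have half (P : {ffun 'I_k.+3 -> 'I_M.+1} -> bool) i j :
  \sum_(t in box V) (P t && chi (t i, t j))%:R = (\sum_(t in box V) (P t)%:R +
     \sum_(t in box V) (P t)%:R * sign R (chi (t i, t j))) / 2.
  rewrite -big_split /= mulr_suml; apply: eq_bigr => t _; rewrite /sign.
  by case: (P t); case: (chi _) => /=; field.
have halfN (P : {ffun 'I_k.+3 -> 'I_M.+1} -> bool) i j :
  \sum_(t in box V) (P t && ~~ chi (t i, t j))%:R = (\sum_(t in box V) (P t)%:R -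
     \sum_(t in box V) (P t)%:R * sign R (chi (t i, t j))) / 2.
  rewrite -sumrB mulr_suml; apply: eq_bigr => t _; rewrite /sign.
  by case: (P t); case: (chi _) => /=; field.
rewrite edges_head_tail half halfN sum_chain_in -vol_full.
have := head_disc S; have := tail_disc S; rewrite !ler_norml.
have D0 : 0 <= D * volume R V by apply: le_trans (tail_disc S); exact: normr_ge0.
by move=> /andP[_ h1] /andP[h2 _]; lra.
Qed.

End Density.

Lemma bin_ge (R : realType) (m r : nat) : (0 < r)%N -> (2 * r ^ 2 <= m)%N ->
  m%:R ^+ r <= 2 * (r`!)%:R * 'C(m, r)%:R :> R.
Proof.
move=> r0 rm; have rm' : (r <= m)%N by nia.
have m0 : (0 < m)%N by apply: leq_trans rm'.
have M0 : 0 < m%:R :> R by rewrite ltr0n.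
rewrite -mulrA -natrM mulnC bin_ffact mulrC -ler_pdivrMr //.
apply: le_trans (ffact_ge R (leqnn r) rm' m0).
rewrite ler_wpM2l ?exprn_ge0 // lerBrDr -lerBrDl ler_pdivrMr //.
have : 2 * r%:R ^+ 2 <= m%:R :> R by rewrite -natrX -natrM ler_nat.
by rewrite expr2; lra.
Qed.

Lemma head_tail_edges_ge (R : realType) (r M : nat) (chi : {ffun 'I_M.+1 * 'I_M.+1 -> bool})
    (D : R) (S : {set vertex (head_tail_graph r chi)}) : (3 <= r)%N ->
  (forall A B, `|discrepancy R chi A B| <= D * M.+1%:R ^+ 2) ->
  'C(#|S|, r)%:R / 4 - D * M.+1%:R ^+ r <= (edges_in S)%:R.
Proof. by case: r S => [|[|[|k]]] // S _ disc; apply: edges_head_tail_ge. Qed.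

Lemma free_dense_graph (R : realType) (r : nat) (F : r_graph r) (eps : R) (k : nat) :
  (3 <= r)%N -> head_tail_mixing F -> 0 < eps -> eps <= 1 ->
  exists H : r_graph r, [/\ (k <= #|vertex H|)%N, de_dense (1 / 4) eps H & ~ contains H F].
Proof.
move=> r3 mix eps0 eps1.
have f0 : 0 < (r`!)%:R :> R by rewrite ltr0n fact_gt0.
(* For a set S of at least eps * N vertices, N being the order of the graph, (eps N)^r is at most 2
   r! times the number of [r]-subsets of S. The error D N^r is thus at most [eps] times that
   number. *)
pose D : R := eps ^+ r.+1 / (2 * (r`!)%:R).
have D0 : 0 < D by rewrite divr_gt0 ?exprn_gt0 // mulr_gt0.
have f1 : 1 <= (r`!)%:R :> R by rewrite ler1n fact_gt0.
have D1 : D <= 1.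
  rewrite ler_pdivrMr ?mulr_gt0 // mul1r; apply: (@le_trans _ _ 1); last by lra.
  by rewrite exprn_ile1 // ltW.
have D20 : 0 < D / 2 by rewrite divr_gt0.
have [|N0 HN0] := random_colouring D20.
  by rewrite ler_pdivrMr //; lra.
pose N := (N0 + k + Num.bound (2 * (r ^ 2)%:R / eps))%N.
have [|chi Hchi] := HN0 N.+1; first by rewrite leqW // /N -addnA leq_addr.
have disc A B : `|discrepancy R chi A B| <= D * N.+1%:R ^+ 2.
  by apply: le_trans (Hchi A B) _; rewrite [2 * _]mulrC divfK.
have NE : 2 * (r ^ 2)%:R <= eps * N.+1%:R.
  rewrite [leRHS]mulrC -ler_pdivrMr //.
  apply: le_trans (ltW (archi_boundP _)) _; first by rewrite divr_ge0 // ltW.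
  by rewrite ler_nat leqW // /N leq_addl.
exists (head_tail_graph r chi); split.
- by rewrite /= card_ord leqW // /N addnAC leq_addl.
- move=> S; rewrite /= card_ord => HS; apply: le_trans (head_tail_edges_ge S r3 disc).
  rewrite mulrBl mul1r mulrC lerD2l lerN2.
  have s2 : (2 * r ^ 2 <= #|S|)%N.
    by rewrite -(ler_nat R) natrM; apply: le_trans NE HS.
  have Hb := bin_ge R (ltnW (ltnW r3)) s2.
  have HN : eps ^+ r * N.+1%:R ^+ r <= 2 * (r`!)%:R * 'C(#|S|, r)%:R.
    rewrite -exprMn; apply: le_trans Hb; by apply: lerXn2r; rewrite ?nnegrE ?mulr_ge0 // ltW.
  rewrite /D mulrAC ler_pdivrMr ?mulr_gt0 // exprS -!mulrA ler_wpM2l ?(ltW eps0) //.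
  by rewrite [leRHS]mulrC.
- exact: head_tail_free.
Qed.

Lemma avoidable_quarter (R : realType) (r : nat) (F : r_graph r) :
  (3 <= r)%N -> head_tail_mixing F -> avoidable_density F (1 / 4 : R).
Proof.
move=> r3 mix.
have /choice[H HP] : forall k : nat, exists H : r_graph r,
    [/\ (k <= #|vertex H|)%N, de_dense (1 / 4) (k.+1%:R^-1 : R) H & ~ contains H F].
  by move=> k; apply: free_dense_graph; rewrite // ?invf_le1 ?ler1n.
exists H; split; last by move=> k; have [] := HP k.
split.
  exists (fun k => k.+1%:R^-1); split; first exact: cvg_harmonic.
  by move=> k; have [] := HP k.
apply/cvgnyPge => A; exists A => // k /= Ak; apply: leq_trans Ak _.
by have [] := HP k.
Qed.

Theorem theorem3p1 (R : realType) (r : nat) (F : r_graph r) :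
  (3 <= r)%N ->
  quasi_linear F ->
  head_tail_mixing F ->
  admits F (xzy_seq r) ->
  is_pi_u F (1 / 4 : R).
Proof.
move=> r3 qF mix aF; split; first exact: avoidable_quarter.
by move=> d; apply: density_le_quarter.
Qed.
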